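(* Let $S$ be a set of $n\ge 4$ points in general position in the plane. Then $S$ is in convex position if and only if all roots of the Voronoi polynomial $p_V(z)=\sum_{k=1}^{n-1} v_k z^{k-1}$ of $S$ lie on the unit circle $\{z\in\mathbb{C}:|z|=1\}$.
   Context: General position means no three points of $S$ are collinear and no four points of $S$ are cocircular. For $1\le k\le n-1$, the order-$k$ Voronoi diagram of $S$ is the subdivision of the plane into cells such that points in the same cell have the same set of $k$ nearest points of $S$; $v_k$ is its number of vertices. *)

(* Defs.v *)
From HB Require Import structures.
From mathcomp Require Import all_boot all_order all_algebra finmap.
From mathcomp Require Import complex.
From mathcomp Require Import all_classical all_reals all_analysis.
From mathcomp Require Import lra.

Set Implicit Arguments.
Unset Strict Implicit.
Unset Printing Implicit Defensive.

Import Order.TTheory GRing.Theory Num.Theory.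
Import numFieldNormedType.Exports.

Local Open Scope classical_set_scope.
Local Open Scope ring_scope.

(* The library norm on matrices is the sup norm, hence a separate Euclidean
   distance; the topology of ['rV[R]_2] is the usual one in both cases. *)
Definition edist (R : realType) (x y : 'rV[R]_2) : R :=
  Num.sqrt (\sum_(i < 2) (x ord0 i - y ord0 i) ^+ 2).

Definition collinear (R : realType) (A : set 'rV[R]_2) : Prop :=
  exists p d : 'rV[R]_2, d != 0 /\
    forall a, A a -> exists t : R, a = p + t *: d.

Definition cocircular (R : realType) (A : set 'rV[R]_2) : Prop :=
  exists (c : 'rV[R]_2) (r : R), 0 < r /\ forall a, A a -> edist a c = r.

Definition general_position (R : realType) (S : {fset 'rV[R]_2}) : Prop :=
  (forall T : {fset 'rV[R]_2},
     (T `<=` S)%fset -> #|` T| = 3%N -> ~ collinear [set` T]) /\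
  (forall T : {fset 'rV[R]_2},
     (T `<=` S)%fset -> #|` T| = 4%N -> ~ cocircular [set` T]).

Definition convex_hull (R : realType) (A : set 'rV[R]_2) : set 'rV[R]_2 :=
  smallest (@convex_set R 'rV[R]_2) A.

Definition convex_position (R : realType) (S : {fset 'rV[R]_2}) : Prop :=
  forall p, p \in S -> ~ convex_hull [set` (S `\ p)%fset] p.

(* [nearest S k T x]: [T] is the set of the [k] nearest points of [S] to [x];
   no such [T] exists when [x] lies on the boundary between cells. *)
Definition nearest (R : realType) (S : {fset 'rV[R]_2}) (k : nat)
    (T : {fset 'rV[R]_2}) (x : 'rV[R]_2) : Prop :=
  [/\ (T `<=` S)%fset, #|` T| = k &
      forall p q, p \in T -> q \in (S `\` T)%fset -> edist x p < edist x q].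

(* The (possibly empty) open cell of the order-[k] Voronoi diagram. *)
Definition voronoi_cell (R : realType) (S : {fset 'rV[R]_2}) (k : nat)
    (T : {fset 'rV[R]_2}) : set 'rV[R]_2 :=
  [set x | nearest S k T x].

(* The vertices of the subdivision are the points at which at least three of
   its cells meet; every [closure] below is that of a nonempty cell. *)
Definition voronoi_vertices (R : realType) (S : {fset 'rV[R]_2}) (k : nat) :
    set 'rV[R]_2 :=
  [set x | exists T1 T2 T3 : {fset 'rV[R]_2},
     [/\ T1 != T2, T1 != T3 & T2 != T3] /\
     [/\ closure (voronoi_cell S k T1) x,
         closure (voronoi_cell S k T2) x &
         closure (voronoi_cell S k T3) x]].

Lemma closure_voronoi_cell (R : realType) (S : {fset 'rV[R]_2}) (k : nat)
    (T : {fset 'rV[R]_2}) (x : 'rV[R]_2) :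
  closure (voronoi_cell S k T) x ->
  [/\ (T `<=` S)%fset, #|` T| = k &
      forall p q, p \in T -> q \in S -> q \notin T -> edist x p <= edist x q].
Proof.
move=> xT.
have [_ [[TS Tk _] _]] := xT setT filterT.
split=> // p q pT qS qT.
have cont (a : 'rV[R]_2) : continuous (fun y : 'rV[R]_2 => edist y a).
  have cc (i : 'I_2) :
      continuous (fun y : 'rV[R]_2 => (y ord0 i - a ord0 i) ^+ 2).
    move=> y; apply: (@continuous_comp _ _ _
      (fun y : 'rV[R]_2 => y ord0 i - a ord0 i) (fun t => t ^+ 2));
      last exact: exprn_continuous.
    apply: continuousB; last exact: cst_continuous.
    exact: (@coord_continuous R 1 2 ord0 i y).
  move=> y; apply: (@continuous_comp _ _ _
    (fun y : 'rV[R]_2 => \sum_(i < 2) (y ord0 i - a ord0 i) ^+ 2) (@Num.sqrt R));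
    last exact: sqrt_continuous.
  have -> : (fun y : 'rV[R]_2 => \sum_(i < 2) (y ord0 i - a ord0 i) ^+ 2) =
      (fun y : 'rV[R]_2 => (y ord0 ord0 - a ord0 ord0) ^+ 2) \+
      (fun y : 'rV[R]_2 => (y ord0 (lift ord0 ord0) -
                            a ord0 (lift ord0 ord0)) ^+ 2).
    by apply/funext => z /=; rewrite !big_ord_recl big_ord0 addr0.
  by apply: continuousD; exact: cc.
have cl : closed [set y : 'rV[R]_2 | edist y p <= edist y q].
  have -> : [set y : 'rV[R]_2 | edist y p <= edist y q] =
      (fun y => edist y q - edist y p) @^-1` [set t : R | 0 <= t].
    by apply/seteqP; split=> y /=; rewrite subr_ge0.
  apply: preimage_closed; last exact: closed_ge.
  move=> y _; apply: (@continuousB _ _ _ (fun y => edist y q)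
    (fun y => edist y p)); exact: cont.
apply: cl; apply: closure_subset xT => y [_ _ h] /=.
by apply/ltW/h => //; rewrite inE qT.
Qed.

Lemma edist_sqr (R : realType) (x y : 'rV[R]_2) :
  edist x y ^+ 2 = (x ord0 ord0 - y ord0 ord0) ^+ 2 +
                   (x ord0 ord_max - y ord0 ord_max) ^+ 2.
Proof.
rewrite sqr_sqrtr; last by apply: sumr_ge0 => i _; rewrite sqr_ge0.
rewrite !big_ord_recl big_ord0 addr0.
by have -> : lift ord0 ord0 = ord_max :> 'I_2 by exact/val_inj.
Qed.

Lemma circumcenter_unique (R : realType) (a b c x y : 'rV[R]_2) :
  ~ collinear [set` [fset a; b; c]%fset] ->
  edist x a = edist x b -> edist x a = edist x c ->
  edist y a = edist y b -> edist y a = edist y c -> x = y.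
Proof.
move=> ncol xab xac yab yac; apply: contrapT => xy; apply: ncol.
pose u := x ord0 ord0 - y ord0 ord0.
pose v := x ord0 ord_max - y ord0 ord_max.
have ord2 (i : 'I_2) : i = ord0 \/ i = ord_max.
  by case: i => -[|[|//]] ?; [left | right]; exact/val_inj.
have n0 : u ^+ 2 + v ^+ 2 != 0.
  rewrite paddr_eq0 ?sqr_ge0 // !sqrf_eq0 !subr_eq0.
  apply/negP => /andP[/eqP u0 /eqP v0]; apply: xy; apply/rowP => i.
  by have [->|->] := ord2 i.
pose d : 'rV[R]_2 := \row_i (if i == ord0 then - v else u).
have d0 : d ord0 ord0 = - v by rewrite mxE.
have d1 : d ord0 ord_max = u by rewrite mxE.
have on e : edist x a = edist x e -> edist y a = edist y e ->
    exists t : R, e = a + t *: d.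
  move=> /(congr1 (fun t => t ^+ 2)) xe /(congr1 (fun t => t ^+ 2)) ye.
  move: xe ye; rewrite !edist_sqr => xe ye.
  have orth : u * (e ord0 ord0 - a ord0 ord0) +
              v * (e ord0 ord_max - a ord0 ord_max) = 0.
    by rewrite /u /v; lra.
  exists ((u * (e ord0 ord_max - a ord0 ord_max) -
           v * (e ord0 ord0 - a ord0 ord0)) / (u ^+ 2 + v ^+ 2)).
  move: orth; clearbody u v => orth.
  by apply/rowP => i; have [->|->] := ord2 i;
    rewrite !mxE /= mulrAC; apply: (mulIf n0); rewrite mulrDl divfK //;
    move: (congr1 (fun t => t * u) orth) (congr1 (fun t => t * v) orth) => /=;
    lra.
exists a, d; split.
  apply: contra n0 => /eqP dz; move: d0 d1; rewrite dz !mxE => v0 <-.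
  by rewrite -[v]opprK -v0 oppr0 expr0n addr0.
move=> e /=; rewrite !inE -orbA => /or3P[] /eqP ->; [|exact: on..].
by exists 0; rewrite scale0r addr0.
Qed.

Lemma finite_voronoi_vertices (R : realType) (S : {fset 'rV[R]_2}) (k : nat) :
  general_position S -> finite_set (voronoi_vertices S k).
Proof.
move=> [gp _].
pose F (t : 'rV[R]_2 * 'rV[R]_2 * 'rV[R]_2) : set 'rV[R]_2 :=
  [set x | [/\ t.1.1 \in S, t.1.2 \in S & t.2 \in S] /\
    [/\ t.1.1 != t.1.2, t.1.1 != t.2 & t.1.2 != t.2] /\
    (edist x t.1.1 = edist x t.1.2 /\ edist x t.1.1 = edist x t.2)].
apply: (@sub_finite_set _ _
  (\bigcup_(t in ([set` S] `*` [set` S]) `*` [set` S]) F t)); last first.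
  apply: bigcup_finite => [|[[a b] c] _].
    by do !apply: finite_setX; exact: finite_fset.
  have [[x Fx]|nF] := pselect (exists x, F (a, b, c) x); last first.
    by apply: (@sub_finite_set _ _ set0) => // x Fx; case: nF; exists x.
  apply: (@sub_finite_set _ _ [set x]) => // y Fy /=.
  move: Fx Fy => [[/= aS bS cS] [[ab ac bc] [xb xc]]] [_ [_ [/= yb yc]]].
  apply: (circumcenter_unique _ yb yc xb xc); apply: gp.
    by apply/fsubsetP => e; rewrite !inE -orbA => /or3P[] /eqP ->.
  by rewrite -fsetUA cardfsU1 cardfs2 !inE negb_or ab ac bc.
move=> x [T1 [T2 [T3 [[n12 n13 n23] [c1 c2 c3]]]]].
have [S1 k1 h1] := closure_voronoi_cell c1.
have [S2 k2 h2] := closure_voronoi_cell c2.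
have [S3 k3 h3] := closure_voronoi_cell c3.
have diff (T T' : {fset 'rV[R]_2}) : #|` T| = k -> #|` T'| = k -> T != T' ->
    exists2 p, p \in T & p \notin T'.
  move=> Tk T'k /negP nT; apply: contrapT => no; apply: nT.
  rewrite eqEfcard Tk T'k leqnn andbT; apply/fsubsetP => p pT.
  by apply: contrapT => /negP pT'; apply: no; exists p.
have [p p1 p2] := diff _ _ k1 k2 n12.
have [q q2 q1] : exists2 q, q \in T2 & q \notin T1.
  by apply: diff => //; rewrite eq_sym.
have [p' p'1 p'3] := diff _ _ k1 k3 n13.
have [q' q'3 q'1] : exists2 q, q \in T3 & q \notin T1.
  by apply: diff => //; rewrite eq_sym.
have [p'' p''2 p''3] := diff _ _ k2 k3 n23.
have pS := fsubsetP S1 _ p1; have p'S := fsubsetP S1 _ p'1.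
have qS := fsubsetP S2 _ q2; have p''S := fsubsetP S2 _ p''2.
have q'S := fsubsetP S3 _ q'3.
have pq := h1 _ _ p1 qS q1; have qp := h2 _ _ q2 pS p2.
have pq' := h1 _ _ p1 q'S q'1; have p'q := h1 _ _ p'1 qS q1.
have q'p' := h3 _ _ q'3 p'S p'3; have q'p'' := h3 _ _ q'3 p''S p''3.
have npq : p != q by apply: contraNneq q1 => <-.
have tri c : c \in S -> p != c -> q != c -> edist x p = edist x c ->
    (\bigcup_(t in ([set` S] `*` [set` S]) `*` [set` S]) F t) x.
  move=> cS pc qc xc; exists (p, q, c) => //=.
  by split=> //; split=> //; split=> //; apply/eqP; rewrite eq_le pq qp.
have [pp'|pp'] := eqVneq p p'; last first.
  apply: (tri p') => //; first by apply: contraNneq q1 => ->.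
  by apply/eqP; rewrite eq_le (le_trans pq' q'p') (le_trans p'q qp).
have [qq'|qq'] := eqVneq q q'; last first.
  apply: (tri q') => //; first by apply: contraNneq q'1 => <-.
  by apply/eqP; rewrite eq_le pq' (le_trans q'p') // (le_trans p'q qp).
have q3 : q \in T3 by rewrite qq'.
have qp'' : q != p'' by apply: contraNneq p''3 => <-.
have np'' : p != p'' by apply: contraNneq p2 => ->.
have [p''1|p''1] := boolP (p'' \in T1).
  apply: (tri p'') => //; apply/eqP; rewrite eq_le (le_trans pq' q'p'').
  by rewrite (le_trans (h1 _ _ p''1 qS q1) qp).
apply: (tri p'') => //; apply/eqP; rewrite eq_le (h1 _ _ p1 p''S p''1).
by rewrite (h2 _ _ p''2 pS p2).
Qed.

(* Junk value [0] if the set of vertices were infinite; ruled out by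
   [finite_voronoi_vertices]. *)
Definition num_voronoi_vertices (R : realType) (S : {fset 'rV[R]_2})
    (k : nat) : nat :=
  #|` fset_set (voronoi_vertices S k)|.

Definition voronoi_poly (R : realType) (S : {fset 'rV[R]_2}) : {poly R[i]} :=
  \sum_(1 <= k < #|` S|) (num_voronoi_vertices S k)%:R *: 'X^(k.-1).

(* Main.v *)
From mathcomp Require Import all_boot all_order all_algebra finmap complex.
From mathcomp Require Import all_classical all_reals all_analysis.
From mathcomp Require Import ring lra zify.
(* Last, because mathcomp-analysis has an [edist] of its own. *)
Require Import Defs.

(* Let [P = \sum_t X^(e t)] over the triples [t] of points, [e t] being the number
   of points strictly inside the circumcircle of [t]. A circumcentre is a vertex of
   the Voronoi diagrams of orders [e t + 1] and [e t + 2] exactly, so that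
   [p_V = (1 + X) P].

   For a pair of points with [r] points on its right and [l] on its left, the number
   of points inside a circle through the pair changes by one each time the circle,
   moving along its pencil, hits a third point; telescoping,
   [(1 - X) \sum_p (+-) X^(e of the pair and p) = X^r - X^l], with sign [+] for [p] on
   the left. In convex position, summing over all pairs [i < m] of the cyclic order
   gives [P] itself, whence
   [(1 - X)^3 P = (n-2) - n X + n X^(n-1) - (n-2) X^n],
   and comparing real parts and using Cauchy-Schwarz locates its roots.

   Conversely, [P] has degree [n - 3], so if its roots lie on the unit circle then
   [2 P'(1) = (n-3) P(1)]. Counting by quadruples, [P'(1)] is the sum over the
   quadruples of points of the number of their circumcircles enclosing the fourth
   point, which is 2 for a quadruple in convex position and 1 otherwise, while
   [(n-3) P(1)] is four times the number of quadruples. Hence all quadruples are in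
   convex position. *)

Set Implicit Arguments.
Unset Strict Implicit.
Unset Printing Implicit Defensive.
Import Order.TTheory GRing.Theory Num.Theory.
Import numFieldNormedType.Exports.
Local Open Scope classical_set_scope.
Local Open Scope ring_scope.

(** * Polynomials with roots on the unit circle *)

Lemma geometric_sum (R : comNzRingType) (z : R) n :
  (1 - z) * \sum_(i < n) z ^+ i = 1 - z ^+ n.
Proof. by rewrite -opprB mulNr -subrX1 opprB. Qed.

(** Strict Cauchy-Schwarz against the all-ones vector: twice the gap is the sum of all squares
    [(r ^+ i - r ^+ j) ^+ 2], and the pair of extreme indices contributes
    [(1 - r ^+ N) ^+ 2 > 0]. *)
Lemma sqr_sum_pow_lt (R : numDomainType) (r : R) N : 0 <= r -> r != 1 ->
  (0 < N)%N ->
  (\sum_(i < N.+1) r ^+ i) ^+ 2 < N.+1%:R * \sum_(i < N.+1) (r ^+ 2) ^+ i.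
Proof.
move=> r0 r1 N0.
have real i : r ^+ i \is Num.real by rewrite rpredX // ger0_real.
suff: 0 < \sum_(i < N.+1) \sum_(j < N.+1) (r ^+ i - r ^+ j) ^+ 2.
  have -> : \sum_(i < N.+1) \sum_(j < N.+1) (r ^+ i - r ^+ j) ^+ 2 =
     (N.+1%:R * \sum_(i < N.+1) (r ^+ 2) ^+ i
        - (\sum_(i < N.+1) r ^+ i) ^+ 2) *+ 2.
    set s := \sum_(i < N.+1) r ^+ i; set q := \sum_(i < N.+1) (r ^+ 2) ^+ i.
    have inner (i : 'I_N.+1) : \sum_(j < N.+1) (r ^+ i - r ^+ j) ^+ 2 =
        N.+1%:R * (r ^+ 2) ^+ i + q - 2 * s * r ^+ i.
      under eq_bigr => j _ do rewrite sqrrB -!exprM mulnC (mulnC j) !exprM.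
      rewrite big_split sumrB /= sumr_const card_ord -/q.
      rewrite sumrMnl -mulr_sumr -/s -[_ *+ N.+1]mulr_natl.
      by move: (r ^+ i) ((r ^+ 2) ^+ i) N.+1%:R => x y k; ring.
    rewrite (eq_bigr _ (fun i _ => inner i)) sumrB big_split /= -!mulr_sumr.
    rewrite sumr_const card_ord -/s -/q -[q *+ N.+1]mulr_natl.
    by clear inner; move: s q N.+1%:R => x y k; ring.
  by rewrite pmulrn_lgt0 // subr_gt0.
rewrite (bigD1 ord0) //= (bigD1 ord_max) //= ltr_wpDr //.
  by apply: sumr_ge0 => i _; apply: sumr_ge0 => j _; rewrite real_exprn_even_ge0 ?rpredB.
rewrite ltr_wpDr //.
  by apply: sumr_ge0 => i _; rewrite real_exprn_even_ge0 ?rpredB.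
rewrite real_exprn_even_gt0 ?rpredB //= expr0 subr_eq0 eq_sym.
by rewrite (pexpr_eq1 N0 r0).
Qed.

(* With [w = z ^+ N.+1] the hypothesis says
   [N.+1 (1 + w) / (1 - w) = (1 + z) / (1 - z)]; compare real parts. *)
Lemma norm_eq1_of_trinomial (C : numClosedFieldType) (z : C) N : (0 < N)%N ->
  N%:R - N.+2%:R * z + N.+2%:R * z ^+ N.+1 - N%:R * z ^+ N.+2 = 0 -> `|z| = 1.
Proof.
move=> N0 Ez; apply/eqP; apply: contraT => r1.
have z1 : z != 1 by apply: contraNneq r1 => ->; rewrite normr1.
pose w := z ^+ N.+1.
have E : N.+1%:R * (1 + w) * (1 - z) = (1 - w) * (1 + z).
  apply/eqP; rewrite -subr_eq0; apply/eqP; rewrite -[RHS]Ez [z ^+ N.+2]exprS -/w.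
  by rewrite -[N.+2%:R]natr1 -[N.+1%:R]natr1; ring.
(* The real part of [(1 + z) / (1 - z)] is [(1 - |z|^2) / |1 - z|^2]. Denominators are cleared, so
   [w = 1] needs no separate case; adding [E] and its conjugate gives twice the claim. *)
have E2 : N.+1%:R * (1 - `|w| ^+ 2) * `|1 - z| ^+ 2 =
          `|1 - w| ^+ 2 * (1 - `|z| ^+ 2).
  have Ec := congr1 Num.conj E.
  move: Ec; rewrite !(rmorphM, rmorphB, rmorphD, rmorph1, rmorph_nat) => Ec.
  rewrite !normCK !(rmorphB, rmorph1).
  set u := w^* in Ec *; set v := z^* in Ec *.
  have two : (2 : C) != 0 by rewrite pnatr_eq0.
  apply: (mulfI two).
  move: (congr1 (fun t => t * ((1 - u) * (1 - v))) E).
  move: (congr1 (fun t => t * ((1 - w) * (1 - z))) Ec) => /= e1 e2.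
  transitivity (N.+1%:R * (1 + u) * (1 - v) * ((1 - w) * (1 - z)) +
     N.+1%:R * (1 + w) * (1 - z) * ((1 - u) * (1 - v))); first by ring.
  by rewrite e1 e2; ring.
pose r := `|z|.
have r0 : 0 <= r := normr_ge0 z.
have dz : 0 < `|1 - z| by rewrite normr_gt0 subr_eq0 eq_sym.
have dr : 1 - r ^+ 2 != 0.
  by rewrite subr_eq0 eq_sym (pexpr_eq1 _ r0).
have wr : 1 - `|w| ^+ 2 = (1 - r ^+ 2) * \sum_(i < N.+1) (r ^+ 2) ^+ i.
  by rewrite geometric_sum normrX -!exprM mulnC.
have wz : `|1 - w| = `|1 - z| * `|\sum_(i < N.+1) z ^+ i|.
  by rewrite -geometric_sum normrM.
(* Both sides of [E2] share the nonzero factors [1 - r ^+ 2] and [|1 - z|^2]. What remains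
   contradicts [sqr_sum_pow_lt], since the triangle inequality bounds the right-hand side by the
   squared sum of the [r ^+ i]. *)
have E3 : N.+1%:R * \sum_(i < N.+1) (r ^+ 2) ^+ i =
          `|\sum_(i < N.+1) z ^+ i| ^+ 2.
  have dz2 : `|1 - z| ^+ 2 != 0 by rewrite expf_neq0 // gt_eqF.
  apply: (mulIf dz2); apply: (mulIf dr).
  move: E2; rewrite wr wz -/r => E2.
  transitivity (N.+1%:R * ((1 - r ^+ 2) * (\sum_(i < N.+1) (r ^+ 2) ^+ i)) *
    `|1 - z| ^+ 2); first by ring.
  by rewrite E2; ring.
have := sqr_sum_pow_lt r0 r1 N0; rewrite E3 => lt.
have : `|\sum_(i < N.+1) z ^+ i| ^+ 2 <= (\sum_(i < N.+1) r ^+ i) ^+ 2.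
  rewrite lerXn2r ?nnegrE ?sumr_ge0 // => [i _|]; first by rewrite exprn_ge0.
  by rewrite (le_trans (ler_norm_sum _ _ _)) // ler_sum // => i _; rewrite normrX.
by move=> /(lt_le_trans lt); rewrite ltxx.
Qed.

(** The logarithmic derivative at 1 is the sum of the [1 / (1 - w)], and each of these has real part
    1/2 when [|w| = 1]. *)
Lemma deriv_prod_unit_circle (C : numClosedFieldType) (s : seq C) :
  (forall w, w \in s -> `|w| = 1) -> 1 \notin s ->
  let p := \prod_(w <- s) ('X - w%:P) in
  let q := p^`().[1] / p.[1] in p.[1] != 0 /\ q + q^* = (size s)%:R.
Proof.
elim: s => [_ _|w s IH ns].
  rewrite /= big_nil (_ : 1^`() = 0); last exact: derivC.
  by rewrite horner0 hornerC mul0r conjC0 addr0 oner_neq0.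
rewrite inE negb_or => /andP[w1 s1].
have [|p1 q1] := IH _ s1; first by move=> v vs; apply: ns; rewrite inE vs orbT.
rewrite /= big_cons; set p := \prod_(_ <- s) _ in p1 q1 *.
rewrite derivM derivXsubC mul1r !hornerE.
have w10 : 1 - w != 0 by rewrite subr_eq0.
split; first by rewrite mulf_neq0.
have wn : w * w^* = 1 by rewrite -normCK (ns w) ?mem_head ?expr1n.
have cw10 : 1 - w^* != 0 by rewrite -(conjC1 C) -rmorphB conjC_eq0.
have -> : (p.[1] + (1 - w) * p^`().[1]) / ((1 - w) * p.[1]) =
   (1 - w)^-1 + p^`().[1] / p.[1] by field; rewrite p1 w10.
rewrite rmorphD /= addrACA q1 fmorphV rmorphB rmorph1 /= -natr1 addrC; congr (_ + _).
have -> : (1 - w)^-1 + (1 - w^* )^-1 =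
  (1 - w - w^* + 1) / ((1 - w) * (1 - w^* )) by field; rewrite w10 cw10.
rewrite [X in X / _](_ : _ = (1 - w) * (1 - w^* )) ?divff ?mulf_neq0 //.
by rewrite -{2}wn; ring.
Qed.

(** The quotient [b / a] is its own conjugate, so the preceding identity reads [2 b / a = d];
    [a > 0] ensures that 1 is not a root. *)
Lemma deriv_unit_circle (C : numClosedFieldType) (p : {poly C}) d (a b : nat) :
  size p = d.+1 -> (forall z, root p z -> `|z| = 1) ->
  (0 < a)%N -> p.[1] = a%:R -> p^`().[1] = b%:R -> (2 * b = d * a)%N.
Proof.
move=> sp rt a0 pa pb.
have [s Es] := closed_field_poly_normal p.
have p0 : p != 0 by rewrite -size_poly_eq0 sp.
have lc : lead_coef p != 0 by rewrite lead_coef_eq0.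
have rs w : (w \in s) = root p w by rewrite Es rootZ // root_prod_XsubC.
have ss : size s = d.
  by move: sp; rewrite Es size_scale // size_prod_XsubC => -[].
have [w||q1] := @deriv_prod_unit_circle C s; rewrite ?rs; first exact: rt.
  by rewrite rootE pa pnatr_eq0 -lt0n.
set q := \prod_(w <- s) _ in q1 *.
have -> : q^`().[1] / q.[1] = b%:R / a%:R.
  rewrite -pa -pb Es -/q derivZ !hornerZ; field.
  by rewrite lc q1.
rewrite ss rmorphM fmorphV !rmorph_nat => /eqP.
have an0 : a%:R != 0 :> C by rewrite pnatr_eq0 -lt0n.
rewrite -(inj_eq (mulIf an0)) mulrDl divfK // -natrD -natrM eqr_nat => /eqP <-.
by rewrite mul2n addnn.
Qed.

(* Rotating a circle about two fixed points: [t] is the position of its centre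
   when it hits [p], and [b p] tells whether [p] enters or leaves. The number of
   enclosed points changes by one at each hit, so the sum telescopes. *)
Lemma pencil_sum (R : comNzRingType) (d : Order.disp_t) (T : orderType d)
    (I : eqType) (s : seq I) (t : I -> T) (b : pred I) (z : R) :
  uniq s -> {in s &, injective t} ->
  (1 - z) * \sum_(p <- s) (if b p then 1 else -1) *
     z ^+ count (fun q => if b q then (t q < t p)%O else (t p < t q)%O) s =
  z ^+ count (predC b) s - z ^+ count b s.
Proof.
pose r p q := (t q <= t p)%O.
have rtot : total r by move=> p q; exact: le_total.
have rtr : transitive r by move=> y x w h1 h2; apply: le_trans h2 h1.
have ps : perm_eq (sort r s) s by rewrite perm_sort.
move=> us it; rewrite -(perm_big _ ps) -!(seq.permP ps) /=.
under eq_bigr => p _ do rewrite -(seq.permP ps) /=.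
have : uniq (sort r s) by rewrite sort_uniq.
have : {in sort r s &, injective t}.
  by move=> x y; rewrite !mem_sort; exact: it.
have : pairwise r (sort r s).
  by rewrite -sorted_pairwise //; exact: sort_sorted.
(* The order is decreasing, so the head [m] has the largest position. The points counted at [m] are
   those with [b] true, and [m] is counted at every later point exactly when [b m] is false, which
   multiplies the remaining sum by [z]. *)
elim: (sort r s) => [_ _ _|m {ps us it}s IH].
  by rewrite big_nil /= !expr0 subrr mulr0.
rewrite /= => /andP[/allP ms ss] it /andP[nm us].
have lt p : p \in s -> (t p < t m)%O.
  move=> ps; rewrite lt_neqAle (ms p ps : (t p <= t m)%O) andbT.
  by apply: contraNneq nm => e; rewrite -(it p m) ?inE ?eqxx ?ps ?orbT.
have it' : {in s &, injective t}.
  by move=> x y xs ys; apply: it; rewrite inE ?xs ?ys orbT.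
have {}IH := IH ss it' us.
have hm : count (fun q => if b q then (t q < t m)%O else (t m < t q)%O) s = count b s.
  apply: eq_in_count => q /lt h; case: (b q) => //.
  by apply/negbTE; rewrite -leNgt ltW.
rewrite big_cons /= hm ltxx.
have [bm|bm] := boolP (b m) => /=.
  rewrite mul1r !add0n mulrDr.
  rewrite (_ : (1 - z) * (\sum_(_ <- _) _) = z ^+ count (predC b) s - z ^+ count b s).
    by rewrite add1n exprS; ring.
  rewrite -IH; congr (_ * _); apply: eq_big_seq => p ps.
  by rewrite (_ : (t m < t p)%O = false) //; apply/negbTE; rewrite -leNgt ltW ?lt.
under eq_big_seq => p ps do rewrite lt // exprD mulrCA.
by rewrite -mulr_sumr mulrDr [X in _ + X]mulrCA IH add1n add0n exprS expr1; ring.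
Qed.

(** * Sums over increasing triples and quadruples of indices *)

Section OrdinalSums.
Variables (V : nmodType) (n : nat).

Definition increasing_triple (t : 'I_n * 'I_n * 'I_n) :=
  (t.1.1 < t.1.2)%N && (t.1.2 < t.2)%N.

Lemma sum_increasing_triple (F : 'I_n -> 'I_n -> 'I_n -> V) :
  \sum_(t | increasing_triple t) F t.1.1 t.1.2 t.2 =
  \sum_i \sum_j \sum_k F i j k *+ ((i < j)%N && (j < k)%N).
Proof.
rewrite pair_bigA pair_bigA big_mkcond /=; apply: eq_bigr => -[[i j] k] _ /=.
by rewrite mulrb.
Qed.

Lemma rotate_sum3 (F : 'I_n -> 'I_n -> 'I_n -> V) :
  \sum_i \sum_j \sum_k F i j k = \sum_k \sum_i \sum_j F i j k.
Proof. by under eq_bigr do rewrite exchange_big; rewrite exchange_big. Qed.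

End OrdinalSums.

(** In each sum a pair [i < j] is marked in a triple, and the third index [k] is respectively the
    least, the middle or the greatest; the symmetry of [G] lets the indices be renamed in increasing
    order. *)
Lemma increasing_triple_mark (V : nmodType) n (G : 'I_n -> 'I_n -> 'I_n -> V) :
  (forall i j k, G i j k = G j i k) -> (forall i j k, G i j k = G i k j) ->
  let T := \sum_(t | increasing_triple t) G t.1.1 t.1.2 t.2 in
  [/\ \sum_i \sum_j \sum_k G i j k *+ ((k < i)%N && (i < j)%N) = T,
      \sum_i \sum_j \sum_k G i j k *+ ((i < k)%N && (k < j)%N) = T &
      \sum_i \sum_j \sum_k G i j k *+ ((i < j)%N && (j < k)%N) = T].
Proof.
move=> G12 G23 /=; rewrite sum_increasing_triple; split=> //.
  rewrite rotate_sum3; apply: eq_bigr => k _; apply: eq_bigr => i _.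
  by apply: eq_bigr => j _; rewrite G23 G12.
apply: eq_bigr => i _; rewrite exchange_big; apply: eq_bigr => k _.
by apply: eq_bigr => j _; rewrite G23.
Qed.

(** A triple with a further index is a set of four indices with one of them singled out; the four
    terms correspond to the rank of the singled-out index. *)
Lemma sum_increasing_quadruple n (G : 'I_n -> 'I_n -> 'I_n -> 'I_n -> nat) :
  (\sum_(t : 'I_n * 'I_n * 'I_n | increasing_triple t)
     \sum_(q | [&& q != t.1.1, q != t.1.2 & q != t.2]) G t.1.1 t.1.2 t.2 q =
   \sum_a \sum_b \sum_c \sum_d
     (G b c d a + G a c d b + G a b d c + G a b c d) *
       [&& a < b, b < c & c < d])%N.
Proof.
have -> : (\sum_(t : 'I_n * 'I_n * 'I_n | increasing_triple t)
     \sum_(q | [&& q != t.1.1, q != t.1.2 & q != t.2]) G t.1.1 t.1.2 t.2 q =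
  \sum_i \sum_j \sum_k \sum_q (G i j k q * [&& q < i, i < j & j < k] +
    G i j k q * [&& i < q, q < j & j < k] +
    G i j k q * [&& i < j, j < q & q < k] +
    G i j k q * [&& i < j, j < k & k < q]))%N.
  rewrite pair_bigA pair_bigA big_mkcond /=; apply: eq_bigr => -[[i j] k] _ /=.
  rewrite /increasing_triple /=; case: ifP => h; last first.
    apply/esym/big1 => q _; rewrite -!mulnDr; apply/eqP; rewrite muln_eq0.
    by apply/orP; right; move: h; lia.
  rewrite big_mkcond; apply: eq_bigr => q _ /=; rewrite -!mulnDr.
  rewrite -!val_eqE /=; case: ifP => h'.
    by rewrite -[LHS]muln1; congr (_ * _)%N; move: h h'; lia.
  by apply/esym/eqP; rewrite muln_eq0; apply/orP; right; move: h h'; lia.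
under eq_bigr => i _ do under eq_bigr => j _ do under eq_bigr => k _ do
  rewrite !big_split /=.
under eq_bigr => i _ do under eq_bigr => j _ do rewrite !big_split /=.
under eq_bigr => i _ do rewrite !big_split /=.
rewrite !big_split /=.
under [RHS]eq_bigr => i _ do under eq_bigr => j _ do under eq_bigr => k _ do
  under eq_bigr => q _ do rewrite !mulnDl.
under [RHS]eq_bigr => i _ do under eq_bigr => j _ do under eq_bigr => k _ do
  rewrite !big_split /=.
under [RHS]eq_bigr => i _ do under eq_bigr => j _ do rewrite !big_split /=.
under [RHS]eq_bigr => i _ do rewrite !big_split /=.
rewrite [RHS]big_split /= [X in _ = (X + _)%N]big_split /=.
rewrite [X in _ = (X + _ + _)%N]big_split /=.
congr (_ + _ + _ + _)%N.
- under eq_bigr => i _ do rewrite (rotate_sum3 (V := nat)).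
  by rewrite exchange_big.
- by apply: eq_bigr => i _; rewrite (rotate_sum3 (V := nat)).
- by apply: eq_bigr => i _; apply: eq_bigr => j _; rewrite exchange_big.
Qed.

(** The exponents are the numbers of vertices on either side of a chord of a convex polygon with
    [N.+2] vertices. One factor [1 - z] telescopes the inner sum, the other the outer one. *)
Lemma sum_arcs (R : comNzRingType) (z : R) N :
  (1 - z) ^+ 2 * (\sum_(i < N.+2) \sum_(m < N.+2 | (i < m)%N)
      (z ^+ (m - i.+1) - z ^+ (N.+1 - (m - i)))) =
  N%:R - N.+2%:R * z + N.+2%:R * z ^+ N.+1 - N%:R * z ^+ N.+2.
Proof.
have inner (i : 'I_N.+2) : (1 - z) * (\sum_(m < N.+2 | (i < m)%N)
      (z ^+ (m - i.+1) - z ^+ (N.+1 - (m - i)))) =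
    1 - z ^+ (N.+1 - i) - z ^+ i + z ^+ N.+1.
  have iN := ltn_ord i.
  have := @telescope_sumr R i.+1 N.+2
    (fun m => - z ^+ (m - i.+1) - z ^+ (N.+2 - (m - i))) iN.
  rewrite big_geq_mkord /=.
  have -> : - z ^+ (N.+2 - i.+1) - z ^+ (N.+2 - (N.+2 - i)) -
    (- z ^+ (i.+1 - i.+1) - z ^+ (N.+2 - (i.+1 - i))) =
    1 - z ^+ (N.+1 - i) - z ^+ i + z ^+ N.+1.
    rewrite subnn subSnn subn1 expr0 subSS subKn ?(ltnW iN) //=; ring.
  move=> <-; rewrite mulr_sumr; apply: eq_bigr => m im.
  have mN := ltn_ord m.
  rewrite (_ : m.+1 - i.+1 = (m - i.+1).+1)%N; last by lia.
  rewrite (_ : N.+2 - (m - i) = (N.+1 - (m - i)).+1)%N; last by lia.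
  rewrite (_ : N.+2 - (m.+1 - i) = (N.+1 - (m - i)))%N; last by lia.
  by rewrite !exprS; ring.
rewrite expr2 -mulrA mulr_sumr; under eq_bigr do rewrite inner.
rewrite big_split !sumrB /= !sumr_const !card_ord.
have -> : \sum_(i < N.+2) z ^+ (N.+1 - i) = \sum_(i < N.+2) z ^+ i.
  rewrite (reindex_inj rev_ord_inj) /=; apply: eq_bigr => i _.
  by congr (_ ^+ _); have := ltn_ord i; lia.
have gs' := geometric_sum z N.+2.
move: gs'; move: (\sum_(i < N.+2) z ^+ i) => s gs'.
rewrite mulrDr !mulrBr gs' -[_ *+ N.+2]mulr_natl -[z ^+ _ *+ N.+2]mulr_natl.
by rewrite -[N.+2%:R]natr1 -[N.+1%:R]natr1 [z ^+ N.+2]exprS; ring.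
Qed.

(** * Orientation and circumcircles *)

Definition abscissa (R : realType) (p : 'rV[R]_2) := p ord0 ord0.
Definition ordinate (R : realType) (p : 'rV[R]_2) := p ord0 ord_max.

Lemma row2P (R : realType) (p q : 'rV[R]_2) :
  abscissa p = abscissa q -> ordinate p = ordinate q -> p = q.
Proof.
move=> h0 h1; apply/rowP => -[[|[|//]] hi].
  by rewrite (_ : Ordinal hi = ord0) //; apply/val_inj.
by rewrite (_ : Ordinal hi = ord_max) //; apply/val_inj.
Qed.

(* Positive iff [a], [b], [c] are in counterclockwise order. *)
Definition orient (R : realType) (a b c : 'rV[R]_2) : R :=
  (abscissa b - abscissa a) * (ordinate c - ordinate a) -
  (ordinate b - ordinate a) * (abscissa c - abscissa a).

(* Zero on the circle with diameter [ab]; the circles through [a] and [b] are the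
   level sets of [diametral a b / orient a b]. *)
Definition diametral (R : realType) (a b p : 'rV[R]_2) : R :=
  (abscissa p - abscissa a) * (abscissa p - abscissa b) +
  (ordinate p - ordinate a) * (ordinate p - ordinate b).

(** The in-circle determinant, alternating in its four arguments. It compares the circles through
    [c] and through [d] in the pencil of [a] and [b]. *)
Definition incircle (R : realType) (a b c d : 'rV[R]_2) : R :=
  diametral a b c * orient a b d - diametral a b d * orient a b c.

Definition inside (R : realType) (a b c d : 'rV[R]_2) : bool :=
  0 < orient a b c * incircle a b c d.

(** The midpoint of [ab], displaced by [t / 2] times [b - a] turned left by a right angle; thus [t]
    locates the centre on the perpendicular bisector. If [orient a b c = 0], division gives [t = 0]
    and the midpoint. *)
Definition circumcenter (R : realType) (a b c : 'rV[R]_2) : 'rV[R]_2 :=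
  let t := diametral a b c / orient a b c in
  \row_i (if i == ord0
          then (abscissa a + abscissa b - t * (ordinate b - ordinate a)) / 2
          else (ordinate a + ordinate b + t * (abscissa b - abscissa a)) / 2).

Lemma orient_swap (R : realType) (a b c : 'rV[R]_2) :
  orient b a c = - orient a b c.
Proof. by rewrite /orient; ring. Qed.

Lemma orient_rot (R : realType) (a b c : 'rV[R]_2) : orient b c a = orient a b c.
Proof. by rewrite /orient; ring. Qed.

Lemma incircle_swap12 (R : realType) (a b c d : 'rV[R]_2) :
  incircle b a c d = - incircle a b c d.
Proof. by rewrite /incircle /diametral /orient; ring. Qed.

Lemma incircle_swap23 (R : realType) (a b c d : 'rV[R]_2) :
  incircle a c b d = - incircle a b c d.
Proof. by rewrite /incircle /diametral /orient; ring. Qed.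

Lemma incircle_swap34 (R : realType) (a b c d : 'rV[R]_2) :
  incircle a b d c = - incircle a b c d.
Proof. by rewrite /incircle /diametral /orient; ring. Qed.

Lemma inside_swap12 (R : realType) (a b c d : 'rV[R]_2) :
  inside b a c d = inside a b c d.
Proof. by rewrite /inside orient_swap incircle_swap12 mulrNN. Qed.

Lemma inside_swap23 (R : realType) (a b c d : 'rV[R]_2) :
  inside a c b d = inside a b c d.
Proof.
by rewrite /inside -orient_rot orient_swap orient_rot incircle_swap23 mulrNN.
Qed.

Lemma inside_vertex (R : realType) (a b c d : 'rV[R]_2) :
  (d == a) || (d == b) || (d == c) -> inside a b c d = false.
Proof.
move=> h; rewrite /inside (_ : incircle a b c d = 0) ?mulr0 ?ltxx //.
by move: h => /orP[/orP[]|] /eqP ->; rewrite /incircle /diametral /orient; ring.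
Qed.

Lemma edist_ge0 (R : realType) (x p : 'rV[R]_2) : 0 <= edist x p.
Proof. exact: sqrtr_ge0. Qed.

Lemma edist_sym (R : realType) (x p : 'rV[R]_2) : edist x p = edist p x.
Proof. by congr Num.sqrt; apply: eq_bigr => i _; rewrite -sqrrN opprB. Qed.

Lemma edist_ltE (R : realType) (x p q : 'rV[R]_2) :
  (edist x p < edist x q) = (edist x p ^+ 2 < edist x q ^+ 2).
Proof. by rewrite ltr_pXn2r ?nnegrE ?edist_ge0. Qed.

Lemma edist_eqE (R : realType) (x p q : 'rV[R]_2) :
  edist x p = edist x q <-> edist x p ^+ 2 = edist x q ^+ 2.
Proof.
split=> [->//|/eqP]; rewrite eqrXn2 ?edist_ge0 //.
by move/eqP.
Qed.

(** The subtracted quotient is minus the power of [p] with respect to the circumcircle, so its sign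
    tells inside from outside. *)
Lemma edist_circumcenter (R : realType) (a b c p : 'rV[R]_2) :
  orient a b c != 0 ->
  edist (circumcenter a b c) p ^+ 2 =
  edist (circumcenter a b c) a ^+ 2 - incircle a b c p / orient a b c.
Proof.
move=> o0; rewrite !edist_sqr !mxE /=.
rewrite /incircle; move: (diametral a b c) => u.
have -> : (u * orient a b p - diametral a b p * orient a b c) / orient a b c =
  u / orient a b c * orient a b p - diametral a b p by field.
by move: (u / _) => t; rewrite /diametral /orient /abscissa /ordinate; field.
Qed.

Lemma circumcenterP (R : realType) (a b c : 'rV[R]_2) : orient a b c != 0 ->
  edist (circumcenter a b c) a = edist (circumcenter a b c) b /\
  edist (circumcenter a b c) a = edist (circumcenter a b c) c.
Proof.
move=> o0.
have on p : incircle a b c p = 0 ->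
    edist (circumcenter a b c) a = edist (circumcenter a b c) p.
  by move=> i0; apply/edist_eqE; rewrite (edist_circumcenter p o0) i0 mul0r subr0.
by split; apply: on; rewrite /incircle /diametral /orient; ring.
Qed.

Lemma inside_edist (R : realType) (a b c p : 'rV[R]_2) : orient a b c != 0 ->
  inside a b c p = (edist (circumcenter a b c) p < edist (circumcenter a b c) a).
Proof.
move=> o0; rewrite edist_ltE (edist_circumcenter p o0) ltrBlDr ltrDl /inside.
have o2 : 0 < orient a b c ^+ 2 by rewrite exprn_even_gt0.
by rewrite -(pmulr_lgt0 _ o2); congr (_ < _); field.
Qed.

Section GeneralPosition.
Variables (R : realType) (S : {fset 'rV[R]_2}).
Hypothesis gpS : general_position S.

Lemma not_collinear (a b c : 'rV[R]_2) : a \in S -> b \in S -> c \in S ->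
  a != b -> a != c -> b != c -> ~ collinear [set` [fset a; b; c]%fset].
Proof.
move=> aS bS cS ab ac bc; apply: gpS.1.
  by apply/fsubsetP => e; rewrite !inE -orbA => /or3P[] /eqP ->.
by rewrite -fsetUA cardfsU1 cardfs2 !inE negb_or ab ac bc.
Qed.

Lemma orient_neq0 (a b c : 'rV[R]_2) : a \in S -> b \in S -> c \in S ->
  a != b -> a != c -> b != c -> orient a b c != 0.
Proof.
move=> aS bS cS ab ac bc; apply: contra_notN (not_collinear aS bS cS ab ac bc).
move=> /eqP o0; exists a, (b - a); split; first by rewrite subr_eq0 eq_sym.
pose u := abscissa b - abscissa a; pose v := ordinate b - ordinate a.
have n0 : u ^+ 2 + v ^+ 2 != 0.
  rewrite paddr_eq0 ?sqr_ge0 // !sqrf_eq0 !subr_eq0.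
  apply: contra ab => /andP[/eqP h0 /eqP h1]; apply/eqP.
  by apply: row2P.
move=> e /=; rewrite !inE -orbA => /or3P[] /eqP ->.
- by exists 0; rewrite scale0r addr0.
- by exists 1; rewrite scale1r addrC subrK.
pose s := abscissa c - abscissa a; pose t := ordinate c - ordinate a.
have h : u * t = v * s by apply/eqP; rewrite -subr_eq0 -[X in _ == X]o0.
(* The coefficient of the orthogonal projection of [c - a] onto [b - a], which avoids a case
   distinction on the vanishing of [u] or [v]. *)
exists ((u * s + v * t) / (u ^+ 2 + v ^+ 2)).
apply: row2P; rewrite /abscissa /ordinate !mxE -/(abscissa _) -/(ordinate _);
  apply/eqP; rewrite addrC -subr_eq; apply/eqP; apply: (mulIf n0);
  rewrite [RHS]mulrAC divfK // -/u -/v -/s -/t.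
- by transitivity (s * u ^+ 2 + v * (v * s)); [ring|rewrite -h; ring].
- by transitivity (t * v ^+ 2 + u * (u * t)); [ring|rewrite h; ring].
Qed.

Lemma not_cocircular (a b c d x : 'rV[R]_2) :
  a \in S -> b \in S -> c \in S -> d \in S ->
  a != b -> a != c -> b != c -> d != a -> d != b -> d != c ->
  edist x a = edist x b -> edist x a = edist x c -> edist x a <> edist x d.
Proof.
move=> aS bS cS dS ab ac bc da db dc xb xc xd.
apply: (gpS.2 [fset d; a; b; c]%fset).
- by apply/fsubsetP => e; rewrite !inE -!orbA => /or4P[] /eqP ->.
- by rewrite -!fsetUA !cardfsU1 cardfs1 !inE !negb_or ab ac bc da db dc.
exists x, (edist x a); split; last first.
  move=> e /=; rewrite !inE -!orbA. rewrite edist_sym.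
  by move=> /or4P[] /eqP ->.
rewrite lt_neqAle edist_ge0 andbT eq_sym; apply: contraNneq ab => xa.
have z p : edist x p = 0 -> p = x.
  move=> /(congr1 (fun t => t ^+ 2)) /eqP; rewrite edist_sqr expr0n /=.
  rewrite paddr_eq0 ?sqr_ge0 // !sqrf_eq0 !subr_eq0 => /andP[/eqP h0 /eqP h1].
  by apply: row2P.
by rewrite (z _ xa) (z b) // -xb.
Qed.

Lemma incircle_neq0 (a b c d : 'rV[R]_2) :
  a \in S -> b \in S -> c \in S -> d \in S ->
  a != b -> a != c -> b != c -> d != a -> d != b -> d != c ->
  incircle a b c d != 0.
Proof.
move=> aS bS cS dS ab ac bc da db dc; apply/eqP => i0.
have o0 := orient_neq0 aS bS cS ab ac bc.
have [xb xc] := circumcenterP o0.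
apply: (not_cocircular aS bS cS dS ab ac bc da db dc xb xc).
by apply/edist_eqE; rewrite (edist_circumcenter d o0) i0 mul0r subr0.
Qed.

Lemma circumcenter_eq (a b c x : 'rV[R]_2) : a \in S -> b \in S -> c \in S ->
  a != b -> a != c -> b != c ->
  edist x a = edist x b -> edist x a = edist x c -> x = circumcenter a b c.
Proof.
move=> aS bS cS ab ac bc xb xc.
have [yb yc] := circumcenterP (orient_neq0 aS bS cS ab ac bc).
exact: circumcenter_unique (not_collinear aS bS cS ab ac bc) xb xc yb yc.
Qed.

End GeneralPosition.

(** * Radial order and convex position *)

Lemma radial_enumeration (R : realType) (S : {fset 'rV[R]_2}) (n : nat) :
  general_position S -> #|` S| = n -> (0 < n)%N ->
  exists f : 'I_n -> 'rV[R]_2,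
    [/\ injective f, forall p, p \in S <-> exists i, p = f i &
        forall i j k : 'I_n, i = 0 :> nat -> (0 < j)%N -> (j < k)%N ->
          0 < orient (f i) (f j) (f k)].
Proof.
move=> gpS Sn n0.
(* As in Graham's scan, the lexicographically least point [p0] comes first and the others are sorted
   by angle around it. *)
pose lexle (p q : 'rV[R]_2) := (abscissa p < abscissa q) ||
  ((abscissa p == abscissa q) && (ordinate p <= ordinate q)).
have lextot : total lexle.
  move=> p q; rewrite /lexle; case: (ltgtP (abscissa p) (abscissa q)) => //= _.
  exact: le_total.
have lextr : transitive lexle.
  move=> q p r /orP[pq|/andP[/eqP pq pq']] /orP[qr|/andP[/eqP qr qr']].
  - by rewrite /lexle (lt_trans pq qr).
  - by rewrite /lexle -qr pq.
  - by rewrite /lexle pq qr.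
  - by rewrite /lexle pq qr eqxx (le_trans pq' qr') orbT.
have : perm_eq (sort lexle S) S by rewrite perm_sort.
have := sort_sorted lextot S.
case: (sort lexle S) => [_ /perm_size /=|p0 s1 /= ps1 perm1].
  by rewrite Sn => n0'; rewrite -n0' in n0.
have us : uniq (p0 :: s1) by rewrite (perm_uniq perm1) fset_uniq.
have min1 := order_path_min lextr ps1.
pose leT p q := 0 <= orient p0 p q.
pose P p := lexle p0 p && (p != p0).
(* Angular comparison is transitive here only because the points of [P] lie in a half-plane at [p0]
   that contains just one of its two boundary rays. *)
have Ptr : {in P & &, transitive leT}.
  move=> v u w; rewrite /P /leT /lexle !unfold_in /orient.
  move=> /andP[v1 v2] /andP[u1 _] /andP[w1 w2].
  set vx := abscissa v - _; set vy := ordinate v - _.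
  set ux := abscissa u - _; set uy := ordinate u - _.
  set wx := abscissa w - _; set wy := ordinate w - _.
  have vwx : 0 <= vx /\ 0 <= wx /\ 0 <= ux.
    rewrite !subr_ge0; split; [|split].
    - by case/orP: v1 => [/ltW//|/andP[/eqP -> _]].
    - by case/orP: w1 => [/ltW//|/andP[/eqP -> _]].
    - by case/orP: u1 => [/ltW//|/andP[/eqP -> _]].
  have ypos p : lexle p0 p -> p != p0 -> abscissa p - abscissa p0 = 0 ->
      0 < ordinate p - ordinate p0.
    move=> le0 np /eqP; rewrite subr_eq0 => /eqP e.
    move: le0; rewrite /lexle e ltxx eqxx /= => le.
    rewrite subr_gt0 lt_neqAle le andbT; apply: contra np => /eqP e'.
    by apply/eqP/row2P.
  move=> uv vw; case: vwx => vx0 [wx0 ux0].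
  have [vxz|vxn] := eqVneq vx 0.
    have vyp : 0 < vy by apply: ypos.
    have wxz : wx = 0 by move: uv vw; rewrite vxz; nra.
    have wyp : 0 < wy by apply: ypos.
    by rewrite wxz mulr0 subr0 mulr_ge0 // ltW.
  have vxp : 0 < vx by rewrite lt_neqAle eq_sym vxn.
  (* By the identity [vx (ux wy - uy wx) = wx (ux vy - uy vx) + ux (vx wy - vy wx)]. *)
  by rewrite -(pmulr_rge0 _ vxp); nra.
have leTtot : total leT.
  move=> p q; rewrite /leT -[X in _ || (_ <= X)]opprK.
  rewrite (_ : - orient p0 q p = orient p0 p q) ?oppr_ge0 ?le_total //.
  by rewrite /orient; ring.
pose s2 := sort leT s1.
have perm2 : perm_eq s2 s1 by rewrite perm_sort.
have us2 : uniq (p0 :: s2).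
  by move: us; rewrite /= (perm_mem perm2) (perm_uniq perm2).
have P2 : all P s2.
  apply/allP => p; rewrite (perm_mem perm2) => ps; rewrite /P.
  rewrite (allP min1 _ ps) /=; apply: contraTneq ps => ->.
  by case/andP: us.
have pw2 : pairwise leT s2.
  by rewrite -(sorted_pairwise_in Ptr P2); exact: sort_sorted.
have memS p : (p \in S) = (p \in p0 :: s2).
  by rewrite -(perm_mem perm1) !inE (perm_mem perm2).
have sz : size (p0 :: s2) = n.
  by rewrite /= (perm_size perm2) -Sn -(perm_size perm1).
exists (fun i => nth p0 (p0 :: s2) i); split.
- by move=> i j /eqP; rewrite nth_uniq ?sz ?ltn_ord // => /eqP /val_inj.
- move=> p; rewrite memS; split=> [ps|[i ->]]; last first.
    by rewrite mem_nth // sz.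
  have ip : (index p (p0 :: s2) < n)%N by rewrite -sz index_mem.
  by exists (Ordinal ip); rewrite [LHS](esym (nth_index p0 ps)).
move=> i [[|j] hj] [[|k] hk] // -> _ /= jk.
have hk' : (k < size s2)%N by rewrite -ltnS -[(size s2).+1]/(size (p0 :: s2)) sz.
have hj' : (j < size s2)%N by apply: ltn_trans hk'.
rewrite lt_neqAle eq_sym; apply/andP; split; last first.
  by move/(pairwiseP p0): pw2; apply=> //; rewrite ?inE.
have mem0 m : (m < size s2)%N -> nth p0 s2 m \in S.
  by move=> hm; rewrite memS inE mem_nth ?orbT.
have ne0 m : (m < size s2)%N -> p0 != nth p0 s2 m.
  move=> hm; case/andP: us2 => ns _; apply: contraNneq ns => ->.
  exact: mem_nth.
apply: (orient_neq0 gpS); rewrite ?mem0 ?ne0 // ?memS ?mem_head //.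
by case/andP: us2 => _ us2; rewrite nth_uniq // ltn_eqF.
Qed.

(** The three orientations are, up to their sum, the barycentric coordinates of [p]; the combination
    is formed first on [bc], then with [a]. *)
Lemma convex_set_triangle (R : realType) (A : set 'rV[R]_2) (a b c p : 'rV[R]_2) :
  convex_set A -> A a -> A b -> A c ->
  0 < orient b c p -> 0 < orient c a p -> 0 < orient a b p -> A p.
Proof.
move=> cA Aa Ab Ac.
have bary : forall x : 'rV[R]_2 -> R, x = @abscissa R \/ x = @ordinate R ->
    (orient b c p + orient c a p + orient a b p) * x p =
    orient b c p * x a + orient c a p * x b + orient a b p * x c.
  by move=> x [] ->; rewrite /orient; ring.
move: (orient b c p) (orient c a p) (orient a b p) bary => u v w bary u0 v0 w0.
have vw0 : 0 < v + w by rewrite addr_gt0.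
have uvw0 : 0 < u + v + w by rewrite !addr_gt0.
have t0 : 0 <= v / (v + w) by rewrite divr_ge0 ?ltW.
have t1 : v / (v + w) <= 1 by rewrite ler_pdivrMr // mul1r lerDl ltW.
have s0 : 0 <= u / (u + v + w) by rewrite divr_ge0 ?ltW.
have s1 : u / (u + v + w) <= 1.
  by rewrite ler_pdivrMr // mul1r -addrA lerDl ltW.
have := cA _ _ (Itv01 s0 s1) (mem_set Aa)
  (cA _ _ (Itv01 t0 t1) (mem_set Ab) (mem_set Ac)).
move=> /set_mem; congr (A _).
have n1 : v + w != 0 by rewrite gt_eqF.
have n2 : u + v + w != 0 by rewrite gt_eqF.
have lin (x : R) (xa xb xc : R) : (u + v + w) * x = u * xa + v * xb + w * xc ->
  u / (u + v + w) * xa + (1 - u / (u + v + w)) *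
    (v / (v + w) * xb + (1 - v / (v + w)) * xc) = x.
  move=> e; apply: (mulfI n2); rewrite e; field.
  by rewrite n1 n2.
apply: row2P; rewrite /abscissa /ordinate !mxE /=; apply: lin.
  by apply: (bary (@abscissa R)); left.
by apply: (bary (@ordinate R)); right.
Qed.

Lemma convex_set_halfplane (R : realType) (u v : 'rV[R]_2) :
  @convex_set R 'rV[R]_2 [set x | 0 <= orient u v x].
Proof.
move=> x y t /set_mem /= hx /set_mem /= hy; apply/mem_set => /=.
have -> : orient u v ((t%:num *: (x : 'rV[R]_2) + (1 - t%:num) *: (y : 'rV[R]_2))) =
    t%:num * orient u v x + (1 - t%:num) * orient u v y.
  by rewrite /orient /abscissa /ordinate !mxE; ring.
by rewrite addr_ge0 // mulr_ge0 // subr_ge0.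
Qed.

Section Enumerated.
Variables (R : realType) (S : {fset 'rV[R]_2}) (n : nat) (f : 'I_n -> 'rV[R]_2).
Hypothesis gpS : general_position S.
Hypothesis f_inj : injective f.
Hypothesis fS : forall p, p \in S <-> exists i, p = f i.

Lemma mem_enumerated i : f i \in S.
Proof. by apply/fS; exists i. Qed.

Lemma orient_enumerated_neq0 i j k : i != j -> i != k -> j != k ->
  orient (f i) (f j) (f k) != 0.
Proof.
by move=> *; apply: (orient_neq0 gpS); rewrite ?mem_enumerated // (inj_eq f_inj).
Qed.

(** The points are listed as the vertices of a convex polygon in cyclic order. *)
Definition counterclockwise := forall i j k : 'I_n, (i < j)%N -> (j < k)%N ->
  0 < orient (f i) (f j) (f k).

(** The line through the two cyclic neighbours of [f j] strictly separates it from the closed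
    half-plane containing the other points, hence from their hull. The first and last indices are
    separate cases because their neighbours wrap around. *)
Lemma counterclockwise_convex : (2 < n)%N -> counterclockwise -> convex_position S.
Proof.
move=> n2 ccw p /fS[j ->] hull.
suff [u [v [huv hj]]] : exists u v : 'I_n, (forall q, q != j ->
    0 <= orient (f u) (f v) (f q)) /\ orient (f u) (f v) (f j) < 0.
  have sub : [set` (S `\ f j)%fset] `<=` [set x | 0 <= orient (f u) (f v) x].
    move=> x /=; rewrite !inE => /andP[xj /fS[q xq]]; rewrite xq huv //.
    by apply: contraNneq xj => <-; rewrite xq.
  have /= h := smallest_sub (@convex_set_halfplane R (f u) (f v)) sub hull.
  by move: hj; rewrite ltNge h.
have rot a b c : orient (f a) (f b) (f c) = orient (f c) (f a) (f b).
  exact: orient_rot.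
have neg a b c : orient (f a) (f b) (f c) = - orient (f b) (f a) (f c).
  exact: orient_swap.
have z1 a b : orient (f a) (f b) (f a) = 0 by rewrite /orient; ring.
have z2 a b : orient (f a) (f b) (f b) = 0 by rewrite /orient; ring.
have n0 : (0 < n)%N by apply: leq_trans n2.
have nn : (n.-1 < n)%N by rewrite prednK.
have [j0|j0] := posnP j.
  have i1 : (1 < n)%N by apply: ltnW.
  exists (Ordinal nn), (Ordinal i1); split; last first.
    by rewrite rot neg oppr_lt0 rot rot; apply: ccw => /=; lia.
  move=> q qj; have [->|q1] := eqVneq q (Ordinal nn); first by rewrite z1.
  have [->|q2] := eqVneq q (Ordinal i1); first by rewrite z2.
  rewrite rot rot; apply/ltW/ccw => /=.
  - by move: qj q2; rewrite -!val_eqE /=; lia.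
  - by move: q1; rewrite -val_eqE /=; have := ltn_ord q; lia.
have jp : (j.-1 < n)%N by have := ltn_ord j; lia.
have [jn|jn] := ltnP j.+1 n; last first.
  exists (Ordinal jp), (Ordinal n0); split; last first.
    rewrite neg oppr_lt0; apply: ccw => /=; lia.
  move=> q qj; have [->|q1] := eqVneq q (Ordinal jp); first by rewrite z1.
  have [->|q2] := eqVneq q (Ordinal n0); first by rewrite z2.
  rewrite rot rot; apply/ltW/ccw => /=.
  - by move: q2; rewrite -val_eqE /=; lia.
  - by move: qj q1; rewrite -!val_eqE /=; have := ltn_ord q; lia.
exists (Ordinal jp), (Ordinal jn); split; last first.
  by rewrite rot neg oppr_lt0; apply: ccw => /=; lia.
move=> q qj; have [->|q1] := eqVneq q (Ordinal jp); first by rewrite z1.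
have [->|q2] := eqVneq q (Ordinal jn); first by rewrite z2.
have [qj'|qj'] := ltnP q j.
  rewrite rot; apply/ltW/ccw => /=; last by lia.
  by move: q1; rewrite -val_eqE /=; lia.
apply/ltW/ccw => /=; first by lia.
by move: qj q2; rewrite -!val_eqE /=; lia.
Qed.

Hypothesis radial : forall i j k : 'I_n, i = 0 :> nat -> (0 < j)%N -> (j < k)%N ->
  0 < orient (f i) (f j) (f k).

(** If an increasing triple avoiding the first index [o] were clockwise, its middle point would lie
    inside the triangle formed by [f o] and the two others. *)
Lemma convex_counterclockwise : convex_position S -> counterclockwise.
Proof.
move=> cS i j k ij jk.
have [i0|i0] := posnP i; first by apply: radial; rewrite // -i0.
have n0 : (0 < n)%N by apply: leq_ltn_trans (ltn_ord i).
pose o := Ordinal n0.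
have o0 : orient (f i) (f j) (f k) != 0.
  by apply: orient_enumerated_neq0; rewrite -val_eqE /= ltn_eqF //; lia.
rewrite lt_neqAle eq_sym o0 leNgt /=; apply/negP => neg.
apply: (cS (f j) (mem_enumerated j)) => C [cC SC].
have mem a : a != j -> C (f a).
  by move=> aj; apply: SC; rewrite /= !inE mem_enumerated andbT (inj_eq f_inj).
apply: (@convex_set_triangle _ _ (f o) (f i) (f k)) => //.
- by apply: mem; rewrite -val_eqE /=; lia.
- by apply: mem; rewrite -val_eqE /=; lia.
- by apply: mem; rewrite -val_eqE /=; lia.
- rewrite (_ : orient _ _ _ = - orient (f i) (f j) (f k)) ?oppr_gt0 //.
  by rewrite /orient; ring.
- by rewrite 2!orient_rot; apply: radial => //; lia.
- by apply: radial => //; lia.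
Qed.

End Enumerated.

(** * Vertices of the Voronoi diagrams *)

Lemma near_affine_gt0 (R : realType) (a b : R) :
  0 < a \/ (a = 0 /\ 0 < b) -> \forall e \near 0^'+, 0 < a + e * b.
Proof.
move=> [a0|[-> b0]]; last first.
  by near=> e; rewrite add0r mulr_gt0 //; near: e; exact: nbhs_right_gt.
have c0 : 0 < a / (`|b| + 1) by rewrite divr_gt0 // ltr_wpDl.
near=> e.
have e0 : 0 < e by near: e; exact: nbhs_right_gt.
have ec : e < a / (`|b| + 1) by near: e; exact: nbhs_right_lt.
rewrite ltr_pdivlMr ?ltr_wpDl // in ec.
have := ler_norm (- b); rewrite normrN => nb.
nra.
Unshelve. all: by end_near. Qed.

(* Moving from [x] in the direction [u] separates [T] from the rest of [S]. *)
Lemma closure_cell_direction (R : realType) (S T : {fset 'rV[R]_2}) (k : nat)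
    (x u : 'rV[R]_2) :
  (T `<=` S)%fset -> #|` T| = k ->
  (forall p q, p \in T -> q \in S -> q \notin T ->
     edist x p < edist x q \/ (edist x p = edist x q /\
     0 < abscissa u * (abscissa p - abscissa q) +
         ordinate u * (ordinate p - ordinate q))) ->
  closure (voronoi_cell S k T) x.
Proof.
move=> TS Tk sep U Ux.
have nearU : \forall e \near (0 : R)^'+, U (x + e *: u).
  have : (x + e *: u) @[e --> (0 : R)^'+] --> x + 0 *: u.
    by apply: cvgD; [exact: cvg_cst|apply: cvgZr_tmp; exact: cvg_within].
  by rewrite scale0r addr0; exact.
(* The pairs range over a finite type, so one small [e] serves all of them. The terms in [e ^+ 2]
   cancel in a difference of squared distances, leaving the affine function [A + e * B]. *)
have nearT : \forall e \near (0 : R)^'+, forall pq : S * S,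
    val pq.1 \in T -> val pq.2 \notin T ->
    edist (x + e *: u) (val pq.1) < edist (x + e *: u) (val pq.2).
  apply: filter_forall => -[[p pS] [q qS]] /=.
  have [pT|pT] := boolP (p \in T); last by near=> e.
  have [qT|qT] := boolP (q \in T); first by near=> e.
  pose A := edist x q ^+ 2 - edist x p ^+ 2.
  pose B := 2 * (abscissa u * (abscissa p - abscissa q) +
                 ordinate u * (ordinate p - ordinate q)).
  have AB : 0 < A \/ (A = 0 /\ 0 < B).
    have [lt|[eq up]] := sep p q pT qS qT.
      by left; rewrite subr_gt0 -edist_ltE.
    by right; rewrite /A eq subrr mulr_gt0.
  have h := near_affine_gt0 AB.
  near=> e => _ _; rewrite edist_ltE -subr_gt0.
  rewrite (_ : _ - _ = A + e * B); first by near: e.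
  rewrite /A /B !edist_sqr !mxE /abscissa /ordinate; ring.
near (0 : R)^'+ => e.
exists (x + e *: u); split; last by near: e.
split=> // p q pT; rewrite inE => /andP[qT qS].
have pS : p \in S by exact: (fsubsetP TS).
have : forall pq : S * S, val pq.1 \in T -> val pq.2 \notin T ->
    edist (x + e *: u) (val pq.1) < edist (x + e *: u) (val pq.2).
  by near: e.
by move=> /(_ ([` pS]%fset, [` qS]%fset)); apply.
Unshelve. all: by end_near. Qed.

Section Vertices.
Variables (R : realType) (S : {fset 'rV[R]_2}).
Hypothesis gpS : general_position S.
Implicit Types (x a b c p q : 'rV[R]_2) (T : {fset 'rV[R]_2}).

Definition closer x a := [fset p in S | edist x p < edist x a]%fset.

Lemma mem_closer x a p : (p \in closer x a) = (p \in S) && (edist x p < edist x a).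
Proof. by rewrite !inE. Qed.

Definition equidistant_triple x a b c :=
  [/\ a \in S, b \in S & c \in S] /\ [/\ a != b, a != c & b != c] /\
  (edist x a = edist x b /\ edist x a = edist x c).

Lemma equidistant_mem x a b c d : equidistant_triple x a b c -> d \in S ->
  edist x a = edist x d -> [\/ d = a, d = b | d = c].
Proof.
move=> [[aS bS cS] [[ab ac bc] [xb xc]]] dS xd.
have [|da] := eqVneq d a; first by constructor 1.
have [|db] := eqVneq d b; first by constructor 2.
have [|dc] := eqVneq d c; first by constructor 3.
by case: (not_cocircular gpS aS bS cS dS ab ac bc da db dc xb xc xd).
Qed.

Lemma equidistant_perm x a b c : equidistant_triple x a b c ->
  equidistant_triple x b a c /\ equidistant_triple x b c a.
Proof.
move=> [[aS bS cS] [[ab ac bc] [xb xc]]].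
have ba : b != a by rewrite eq_sym.
have ca : c != a by rewrite eq_sym.
by do 2 split=> //; split=> //; split=> //; congruence.
Qed.

(** For two points on a circle about [x], this inner product is half the squared distance from [a]
    to [q]. So a move towards [a] favours [a] over the rest of the circle. *)
Lemma dot_equidistant x a q : a != q -> edist x a = edist x q ->
  0 < abscissa (a - x) * (abscissa a - abscissa q) +
      ordinate (a - x) * (ordinate a - ordinate q).
Proof.
move=> aq /edist_eqE; rewrite /abscissa /ordinate !edist_sqr !mxE => e.
have : 0 < (a ord0 ord0 - q ord0 ord0) ^+ 2 +
           (a ord0 ord_max - q ord0 ord_max) ^+ 2.
  rewrite lt_neqAle addr_ge0 ?sqr_ge0 // andbT eq_sym.
  rewrite paddr_eq0 ?sqr_ge0 // !sqrf_eq0 !subr_eq0.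
  by apply: contra aq => /andP[/eqP h0 /eqP h1]; apply/eqP/row2P.
nra.
Qed.

Lemma closure_cell_one x a b c : equidistant_triple x a b c ->
  closure (voronoi_cell S (#|` closer x a|).+1 (a |` closer x a)%fset) x.
Proof.
move=> [[aS _ _] _].
apply: (@closure_cell_direction _ _ _ _ _ (a - x)).
- by apply/fsubsetP => p; rewrite !inE => /orP[/eqP ->//|/andP[]].
- by rewrite cardfsU1 mem_closer ltxx andbF.
move=> p q pT qS; rewrite !inE qS /= negb_or -leNgt => /andP[qa xq].
move: pT; rewrite !inE => /orP[/eqP ->|/andP[_ xp]]; last first.
  by left; apply: lt_le_trans xq.
move: xq; rewrite le_eqVlt => /orP[/eqP xq|]; [right|by left].
by split=> //; apply: dot_equidistant; rewrite // eq_sym.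
Qed.

(** Moving away from [a] makes it the farthest of the three, so [b] and [c] are the next nearest
    points after those inside the circle. *)
Lemma closure_cell_two x a b c : equidistant_triple x a b c ->
  closure (voronoi_cell S (#|` closer x a|).+2 (b |` (c |` closer x a))%fset) x.
Proof.
move=> h; have [[aS bS cS] [[ab ac bc] [xb xc]]] := h.
apply: (@closure_cell_direction _ _ _ _ _ (x - a)).
- by apply/fsubsetP => p; rewrite !inE => /or3P[/eqP ->//|/eqP ->//|/andP[]].
- by rewrite !cardfsU1 !inE -xb -xc !ltxx !andbF (negbTE bc).
move=> p q pT qS; rewrite !inE qS /= !negb_or -leNgt => /and3P[qb qc xq].
have [pI|pI] := boolP (edist x p < edist x a); first by left; apply: lt_le_trans xq.
move: xq; rewrite le_eqVlt => /orP[/eqP xq|xq]; last first.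
  left; move: pT; rewrite !inE (negbTE pI) andbF orbF.
  by move=> /orP[] /eqP ->; rewrite -?xb -?xc.
have [qa|/eqP|/eqP] := equidistant_mem h qS xq; rewrite ?(negbTE qb) ?(negbTE qc) //.
right; rewrite qa.
have [pa xp] : a != p /\ edist x a = edist x p.
  by move: pT; rewrite !inE (negbTE pI) andbF orbF => /orP[] /eqP ->.
split=> //; have := dot_equidistant pa xp; rewrite /abscissa /ordinate !mxE; nra.
Qed.

Lemma voronoi_vertexP x k : voronoi_vertices S k x <->
  exists a b c, equidistant_triple x a b c /\
    ((#|` closer x a|).+1 = k \/ (#|` closer x a|).+2 = k).
Proof.
split; last first.
  move=> [a [b [c [h hk]]]].
  have [[aS bS cS] [[ab ac bc] [xb xc]]] := h.
  have [hb hc] := equidistant_perm h.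
  have [_ hc'] := equidistant_perm hc.
  have eb : closer x b = closer x a by apply/fsetP => p; rewrite !mem_closer xb.
  have ec : closer x c = closer x a by apply/fsetP => p; rewrite !mem_closer xc.
  case: hk => <-.
    exists (a |` closer x a)%fset, (b |` closer x a)%fset, (c |` closer x a)%fset.
    split.
      split; apply/negP => /eqP/fsetP.
      - by move=> /(_ a); rewrite !inE eqxx ltxx andbF (negbTE ab).
      - by move=> /(_ a); rewrite !inE eqxx ltxx andbF (negbTE ac).
      - by move=> /(_ b); rewrite !inE eqxx xb ltxx andbF (negbTE bc).
    split; first exact: closure_cell_one h.
      by have := closure_cell_one hb; rewrite eb.
    by have := closure_cell_one hc'; rewrite ec.
  exists (b |` (c |` closer x a))%fset, (a |` (c |` closer x a))%fset,
    (a |` (b |` closer x a))%fset.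
  split.
    split; apply/negP => /eqP/fsetP.
    - move=> /(_ a); rewrite !inE eqxx ltxx andbF (negbTE ab).
      by rewrite (negbTE ac).
    - move=> /(_ a); rewrite !inE eqxx ltxx andbF (negbTE ab).
      by rewrite (negbTE ac).
    - move=> /(_ b); rewrite !inE eqxx xb ltxx andbF (negbTE bc) eq_sym.
      by rewrite (negbTE ab).
  split; first exact: closure_cell_two h.
    by have := closure_cell_two hb; rewrite eb.
  by have := closure_cell_two hc'; rewrite ec.
move=> [T1 [T2 [T3 [[n12 n13 n23] [c1 c2 c3]]]]].
have [S1 k1 h1] := closure_voronoi_cell c1.
have [S2 k2 h2] := closure_voronoi_cell c2.
have [S3 k3 h3] := closure_voronoi_cell c3.
have diff (T T' : {fset 'rV[R]_2}) : #|` T| = k -> #|` T'| = k -> T != T' ->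
    exists2 p, p \in T & p \notin T'.
  move=> Tk T'k /negP nT; apply: contrapT => no; apply: nT.
  rewrite eqEfcard Tk T'k leqnn andbT; apply/fsubsetP => p pT.
  by apply: contrapT => /negP pT'; apply: no; exists p.
have [p p1 p2] := diff _ _ k1 k2 n12.
have [q q2 q1] : exists2 q, q \in T2 & q \notin T1.
  by apply: diff => //; rewrite eq_sym.
have pS := fsubsetP S1 _ p1; have qS := fsubsetP S2 _ q2.
have pq : p != q by apply: contraNneq q1 => <-.
have xpq : edist x p = edist x q.
  by apply/eqP; rewrite eq_le (h1 _ _ p1 qS q1) (h2 _ _ q2 pS p2).
(* A [good] set consists of all points strictly closer to [x] than [p] and some points of the circle
   about [x] through [p]. *)
pose good T := (forall u, u \in T -> edist x u <= edist x p) /\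
  (forall u, u \in S -> u \notin T -> edist x p <= edist x u).
have g1 : good T1.
  by split=> u => [u1|uS u1]; [rewrite xpq; apply: h1|apply: h1].
have g2 : good T2.
  by split=> u => [u2|uS u2]; [apply: h2|rewrite xpq; apply: h2].
have [p' p'1 p'3] := diff _ _ k1 k3 n13.
have [q' q'3 q'1] : exists2 q, q \in T3 & q \notin T1.
  by apply: diff => //; rewrite eq_sym.
have p'S := fsubsetP S1 _ p'1; have q'S := fsubsetP S3 _ q'3.
have xq' : edist x q' = edist x p.
  apply/eqP; rewrite eq_le g1.2 // andbT.
  by rewrite (le_trans (h3 _ _ q'3 p'S p'3)) // g1.1.
have xp' : edist x p' = edist x p.
  apply/eqP; rewrite eq_le g1.1 //=.
  by rewrite -xq' h3.
have g3 : good T3.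
  split=> u => [u3|uS u3]; first by rewrite -xp'; apply: h3.
  by rewrite -xq'; apply: h3.
have I1 : (closer x p `<=` T1)%fset.
  apply/fsubsetP => u; rewrite mem_closer => /andP[uS xu].
  by apply: contraLR xu => u1; rewrite -leNgt g1.2.
(* With only [p] and [q] on the circle, [T3] would contain [q] but not [p], as [T2] does, and the
   two would coincide. *)
have [c [cS xc] [pc qc]] :
    exists2 c, c \in S /\ edist x p = edist x c & p != c /\ q != c.
  apply: contrapT => no.
  have two u : u \in S -> edist x u = edist x p -> u = p \/ u = q.
    move=> uS xu; apply: contrapT => nu; apply: no; exists u => //.
    by split; apply/eqP => e; apply: nu; [left|right].
  have p3 : p \notin T3.
    by have [<-//|e] := two _ p'S xp'; rewrite -e p'1 in q1.
  have q3 : q \in T3.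
    by have [e|<-//] := two _ q'S xq'; rewrite e p1 in q'1.
  have [v v3 v2] : exists2 v, v \in T3 & v \notin T2.
    by apply: diff => //; rewrite eq_sym.
  have vS := fsubsetP S3 _ v3.
  have xv : edist x v = edist x p.
    by apply/eqP; rewrite eq_le g3.1 // g2.2.
  have [e|e] := two _ vS xv; first by rewrite -e v3 in p3.
  by rewrite e q2 in v2.
have h : equidistant_triple x p q c by [].
exists p, q, c; split=> //.
(* Since [q] is not in [T1], only the membership of [c] is open; it decides between the two
   orders. *)
have ext u : u \in T1 -> u != p -> u != c -> u \in closer x p.
  move=> u1 up uc; have uS := fsubsetP S1 _ u1.
  rewrite mem_closer uS lt_neqAle g1.1 // andbT; apply/eqP => /esym xu.
  have [e|e|e] := equidistant_mem h uS xu.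
  - by rewrite e eqxx in up.
  - by rewrite -e u1 in q1.
  - by rewrite e eqxx in uc.
have [c1'|c1'] := boolP (c \in T1); [right|left].
  rewrite -k1 (_ : T1 = p |` (c |` closer x p))%fset; last first.
    apply/fsetP => u; rewrite 2!in_fset1U.
    have [->//|up] := eqVneq u p; have [->//|uc] := eqVneq u c.
    by apply/idP/idP => [u1|/(fsubsetP I1)//]; exact: ext.
  by rewrite !cardfsU1 !inE -xc !ltxx !andbF (negbTE pc).
rewrite -k1 (_ : T1 = p |` closer x p)%fset; last first.
  apply/fsetP => u; rewrite in_fset1U.
  have [->//|up] := eqVneq u p.
  apply/idP/idP => [u1|/(fsubsetP I1)//]; apply: ext => //.
  by apply: contraNneq c1' => <-.
by rewrite cardfsU1 !inE ltxx andbF.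
Qed.

End Vertices.

(** * Counting enclosed points *)

Section Quadruple.
Variables (R : realType) (a b c d : 'rV[R]_2).

Definition enclosed_count : nat :=
  (inside b c d a + inside a c d b + inside a b d c + inside a b c d)%N.

(* The coefficients on the right are those of the affine dependency between the
   four points, which is why [p] is arbitrary. A point lies inside the circle
   through the other three iff its coefficient and the left-hand side have opposite
   signs; taking for [p] a point whose sign differs from all others then shows
   that these others cannot be the enclosed ones. *)
Lemma incircle_affine_dependency (p : 'rV[R]_2) :
  let pow q := (abscissa q - abscissa p) ^+ 2 + (ordinate q - ordinate p) ^+ 2 in
  incircle a b c d = orient b c d * pow a - orient a c d * pow b +
                     orient a b d * pow c - orient a b c * pow d.
Proof. by rewrite /incircle /diametral /orient; ring. Qed.

Lemma insideE :
  [/\ inside a b c d = (0 < orient a b c * incircle a b c d),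
      inside a b d c = (orient a b d * incircle a b c d < 0),
      inside a c d b = (0 < orient a c d * incircle a b c d) &
      inside b c d a = (orient b c d * incircle a b c d < 0)].
Proof.
split; rewrite /inside //.
- by rewrite incircle_swap34 mulrN oppr_gt0.
- by rewrite incircle_swap34 incircle_swap23 opprK.
- rewrite (_ : incircle b c d a = - incircle a b c d) ?mulrN ?oppr_gt0 //.
  by rewrite /incircle /diametral /orient; ring.
Qed.

Lemma orient_sum :
  orient a b c - orient a b d + orient a c d - orient b c d = 0.
Proof. by rewrite /orient; ring. Qed.

Lemma enclosed_count_le2 : incircle a b c d != 0 -> (enclosed_count <= 2)%N.
Proof.
move=> D0; rewrite /enclosed_count; have [-> -> -> ->] := insideE.
have Dsq : 0 < incircle a b c d * incircle a b c d.
  by rewrite -expr2 exprn_even_gt0.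
have := incircle_affine_dependency a; have := incircle_affine_dependency b.
have := incircle_affine_dependency c; have := incircle_affine_dependency d.
rewrite /= !subrr expr0n /= !addr0 !mulr0 => ed ec eb ea.
pose pos (p q : 'rV[R]_2) :=
  (abscissa q - abscissa p) ^+ 2 + (ordinate q - ordinate p) ^+ 2.
have pos0 p q : 0 <= pos p q by rewrite addr_ge0 ?sqr_ge0.
rewrite -!/(pos _ _) in ea eb ec ed.
move: ea eb ec ed (pos0 a b) (pos0 a c) (pos0 a d) (pos0 b a) (pos0 b c) (pos0 b d)
  (pos0 c a) (pos0 c b) (pos0 c d) (pos0 d a) (pos0 d b) (pos0 d c).
move: (pos a b) (pos a c) (pos a d) (pos b a) (pos b c) (pos b d)
  (pos c a) (pos c b) (pos c d) (pos d a) (pos d b) (pos d c).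
have := orient_sum; move: Dsq {D0 pos0}; move: (incircle a b c d) => D.
move: (orient a b c) (orient a b d) (orient a c d) (orient b c d) => u v w x Dsq s.
have sD : u * D - v * D + w * D - x * D = 0 by rewrite -!mulrBl -mulrDl -mulrBl s mul0r.
move=> ab ac ad ba bc bd ca cb cd da db dc ea eb ec ed.
have {}ea : D * D = 0 - w * D * ab + v * D * ac - u * D * ad by rewrite {1}ea; ring.
have {}eb : D * D = x * D * ba - 0 + v * D * bc - u * D * bd by rewrite {1}eb; ring.
have {}ec : D * D = x * D * ca - w * D * cb + 0 - u * D * cd by rewrite {1}ec; ring.
have {}ed : D * D = x * D * da - w * D * db + v * D * dc - 0 by rewrite {1}ed; ring.
move: (u * D) (v * D) (w * D) (x * D) sD ea eb ec ed => p q r t sD ea eb ec ed.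
move=> ab0 ac0 ad0 ba0 bc0 bd0 ca0 cb0 cd0 da0 db0 dc0.
have ge (y z : R) : 0 < y -> 0 <= z -> 0 <= y * z by move=> /ltW; exact: mulr_ge0.
have le (y z : R) : y < 0 -> 0 <= z -> y * z <= 0 by move=> /ltW; exact: mulr_le0_ge0.
(* The cases left have at least three enclosed points. All four contradict [orient_sum]; with
   exactly three, the dependency based at the remaining point writes [D * D > 0] as a sum of
   nonpositive terms. *)
case: (ltP t 0) => ht; case: (ltP 0 r) => hr; case: (ltP q 0) => hq;
  case: (ltP 0 p) => hp //=; exfalso.
- by lra.
- have := le _ _ ht da0; have := ge _ _ hr db0; have := le _ _ hq dc0; lra.
- have := le _ _ ht ca0; have := ge _ _ hr cb0; have := ge _ _ hp cd0; lra.
- have := le _ _ ht ba0; have := le _ _ hq bc0; have := ge _ _ hp bd0; lra.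
- have := ge _ _ hr ab0; have := le _ _ hq ac0; have := ge _ _ hp ad0; lra.
Qed.

(** Were [orient b c d] negative, the count would be 3 or 1 according to the sign of
    [incircle a b c d]. *)
Lemma enclosed_count_eq2 : incircle a b c d != 0 -> orient b c d != 0 ->
  0 < orient a b c -> 0 < orient a b d -> 0 < orient a c d ->
  enclosed_count = 2 -> 0 < orient b c d.
Proof.
move=> D0 x0 u0 v0 w0; rewrite /enclosed_count; have [-> -> -> ->] := insideE.
rewrite !(pmulr_rgt0 _ u0) (pmulr_rgt0 _ w0) (pmulr_rlt0 _ v0).
case: (ltgtP (orient b c d) 0) x0 => // x0 _.
case: (ltgtP (incircle a b c d) 0) D0 => // D _.
  by rewrite (nmulr_rlt0 _ x0) ltNge ltW.
by rewrite (nmulr_rlt0 _ x0) D.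
Qed.

End Quadruple.

Section Counting.
Variables (R : realType) (S : {fset 'rV[R]_2}) (n : nat) (f : 'I_n -> 'rV[R]_2).
Hypothesis gpS : general_position S.
Hypothesis f_inj : injective f.
Hypothesis fS : forall p, p \in S <-> exists i, p = f i.

Let fmem := mem_enumerated fS.

Definition encl (i j k : 'I_n) : nat :=
  #|[pred q | inside (f i) (f j) (f k) (f q)]|.

Lemma encl_swap12 i j k : encl i j k = encl j i k.
Proof. by apply: eq_card => q; rewrite !inE inside_swap12. Qed.

Lemma encl_swap23 i j k : encl i j k = encl i k j.
Proof. by apply: eq_card => q; rewrite !inE inside_swap23. Qed.

Lemma encl_sum i j k : encl i j k =
  (\sum_(q | [&& q != i, q != j & q != k]) inside (f i) (f j) (f k) (f q))%N.
Proof.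
rewrite /encl -sum1_card big_mkcond [RHS]big_mkcond; apply: eq_bigr => q _ /=.
rewrite inE; case: (boolP [&& _, _ & _]) => [_|]; first by case: inside.
by rewrite !negb_and !negbK orbA => h; rewrite inside_vertex // !(inj_eq f_inj).
Qed.

Lemma sum_avoiding (i j k : 'I_n) : i != j -> i != k -> j != k ->
  (\sum_(q : 'I_n | [&& q != i, q != j & q != k]) 1 = n - 3)%N.
Proof.
move=> ij ik jk; rewrite sum1_card.
have c3 : #|[:: i; j; k]| = 3%N.
  by apply/card_uniqP; rewrite /= !inE negb_or ij ik jk.
have := cardC (mem [:: i; j; k]); rewrite card_ord c3 => cn.
transitivity #|predC (mem [:: i; j; k])|; last by rewrite -[LHS](addKn 3) cn.
by apply: eq_card => q; rewrite !inE !negb_or.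
Qed.

Lemma encl_le i j k : i != j -> i != k -> j != k -> (encl i j k <= n - 3)%N.
Proof.
move=> ij ik jk; rewrite encl_sum -(sum_avoiding ij ik jk).
by apply: leq_sum => q _; case: inside.
Qed.

Lemma incircle_enumerated_neq0 i j k q : i != j -> i != k -> j != k ->
  q != i -> q != j -> q != k -> incircle (f i) (f j) (f k) (f q) != 0.
Proof.
by move=> *; apply: (incircle_neq0 gpS); rewrite ?fmem ?(inj_eq f_inj).
Qed.

Lemma pencil_inj i j p q : p != i -> p != j -> q != i -> q != j -> i != j ->
  diametral (f i) (f j) (f p) / orient (f i) (f j) (f p) =
  diametral (f i) (f j) (f q) / orient (f i) (f j) (f q) -> p = q.
Proof.
move=> pi pj qi qj ij e; apply: contra_eq e => pq.
have i0 : incircle (f i) (f j) (f p) (f q) != 0.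
  by apply: incircle_enumerated_neq0; rewrite // eq_sym.
have op : orient (f i) (f j) (f p) != 0.
  by apply: (orient_enumerated_neq0 gpS f_inj fS); rewrite // eq_sym.
have oq : orient (f i) (f j) (f q) != 0.
  by apply: (orient_enumerated_neq0 gpS f_inj fS); rewrite // eq_sym.
apply: contra i0; rewrite eqr_div // => /eqP e; rewrite /incircle e.
by rewrite subrr.
Qed.

(** As the centre moves to the left of the directed line from [f i] to [f j], the disc grows on the
    left of this line and shrinks on its right. *)
Lemma inside_pencil i j p q : p != i -> p != j -> q != i -> q != j -> i != j ->
  inside (f i) (f j) (f p) (f q) =
  let t r := diametral (f i) (f j) (f r) / orient (f i) (f j) (f r) in
  if 0 < orient (f i) (f j) (f q) then t q < t p else t p < t q.
Proof.
move=> pi pj qi qj ij.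
have op : orient (f i) (f j) (f p) != 0.
  by apply: (orient_enumerated_neq0 gpS f_inj fS); rewrite // eq_sym.
have oq : orient (f i) (f j) (f q) != 0.
  by apply: (orient_enumerated_neq0 gpS f_inj fS); rewrite // eq_sym.
rewrite /inside /incircle /=; move: op oq.
move: (diametral _ _ (f p)) (diametral _ _ (f q)) => u v.
move: (orient _ _ (f p)) (orient _ _ (f q)) => x y x0 y0.
have x2 : 0 < x ^+ 2 by rewrite exprn_even_gt0.
have -> : x * (u * y - v * x) = x ^+ 2 * (y * (u / x - v / y)).
  by field; rewrite x0 y0.
rewrite (pmulr_rgt0 _ x2); case: ifP => hy; first by rewrite pmulr_rgt0 // subr_gt0.
by rewrite nmulr_rgt0 ?subr_lt0 // lt_neqAle y0 leNgt hy.
Qed.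

Lemma pencil_encl (K : comNzRingType) (z : K) i j : i != j ->
  (1 - z) * \sum_(p | (p != i) && (p != j))
    (if 0 < orient (f i) (f j) (f p) then 1 else -1) * z ^+ encl i j p =
  z ^+ #|[pred p | orient (f i) (f j) (f p) < 0]| -
  z ^+ #|[pred p | 0 < orient (f i) (f j) (f p)]|.
Proof.
move=> ij.
pose A := [pred p | (p != i) && (p != j)].
have cA (Q : pred 'I_n) : count Q (enum A) = #|[pred p | A p && Q p]|.
  by rewrite -sum1_count big_enum_cond -sum1_card; apply: eq_bigl.
pose t r := diametral (f i) (f j) (f r) / orient (f i) (f j) (f r).
have t_inj : {in enum A &, injective t}.
  move=> p q; rewrite !mem_enum !inE => /andP[pi pj] /andP[qi qj].
  exact: pencil_inj.
have := pencil_sum (fun p => 0 < orient (f i) (f j) (f p)) z (enum_uniq A) t_inj.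
rewrite !cA big_enum /=.
have o1 : orient (f i) (f j) (f i) = 0 by rewrite /orient; ring.
have o2 : orient (f i) (f j) (f j) = 0 by rewrite /orient; ring.
have -> : #|[pred p | A p && ~~ (0 < orient (f i) (f j) (f p))]| =
    #|[pred p | orient (f i) (f j) (f p) < 0]|.
  apply: eq_card => p; rewrite !inE.
  have [->|pi] := eqVneq p i; first by rewrite o1 ltxx.
  have [->|pj] := eqVneq p j; first by rewrite o2 ltxx.
  rewrite -leNgt le_eqVlt /= (negbTE (orient_enumerated_neq0 gpS f_inj fS _ _ _)) //;
    by rewrite eq_sym.
have -> : #|[pred p | A p && (0 < orient (f i) (f j) (f p))]| =
    #|[pred p | 0 < orient (f i) (f j) (f p)]|.
  apply: eq_card => p; rewrite !inE.
  have [->|pi] := eqVneq p i; first by rewrite o1 ltxx.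
  by have [->|pj] := eqVneq p j; first by rewrite o2 ltxx.
move=> <-; congr (_ * _); apply: eq_bigr => p /andP[pi pj].
congr (_ * _ ^+ _); rewrite cA; apply: eq_card => q; rewrite !inE.
have [->|qi] := eqVneq q i; first by rewrite inside_vertex ?eqxx.
have [->|qj] := eqVneq q j; first by rewrite inside_vertex ?eqxx ?orbT.
by rewrite /= inside_pencil.
Qed.

End Counting.

Lemma card_fset_enum (I : finType) (T : choiceType) (A : {fset T}) (g : I -> T)
    (P : pred I) : {in P &, injective g} ->
  (forall x, x \in A <-> exists2 i, P i & x = g i) -> #|` A| = #|P|.
Proof.
move=> gi gA; rewrite cardE -(size_map g); apply/perm_size/uniq_perm.
- exact: fset_uniq.
- by rewrite map_inj_in_uniq ?enum_uniq // => i j; rewrite !mem_enum; exact: gi.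
move=> x; apply/idP/mapP => [/gA[i Pi ->]|[i Pi ->]].
  by exists i; rewrite ?mem_enum.
by apply/gA; exists i => //; rewrite mem_enum in Pi.
Qed.

Lemma card_ord_interval (n a b : nat) : (b <= n)%N ->
  #|[pred p : 'I_n | (a <= p)%N && (p < b)%N]| = (b - a)%N.
Proof.
move=> bn; rewrite -sum1_card.
under eq_bigl do rewrite inE andbC.
rewrite -(big_geq_mkord a n (fun p => p < b)%N (fun _ => 1)%N).
by rewrite -(big_nat_widen _ _ _ xpredT) // sum_nat_const_nat muln1.
Qed.

(** * The Voronoi polynomial in terms of enclosure counts *)

Section Polynomial.
Variables (R : realType) (S : {fset 'rV[R]_2}) (n : nat) (f : 'I_n -> 'rV[R]_2).
Hypothesis gpS : general_position S.
Hypothesis f_inj : injective f.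
Hypothesis fS : forall p, p \in S <-> exists i, p = f i.

Notation triple := ('I_n * 'I_n * 'I_n)%type.
Notation enc t := (encl f t.1.1 t.1.2 t.2).
Notation center t := (circumcenter (f t.1.1) (f t.1.2) (f t.2)).

Lemma increasing_neq (t : triple) : increasing_triple t ->
  [/\ t.1.1 != t.1.2, t.1.1 != t.2 & t.1.2 != t.2].
Proof.
by case: t => [[i j] k]; rewrite /increasing_triple -!val_eqE /= => h; split; lia.
Qed.

Lemma equidistant_center (t : triple) : increasing_triple t ->
  equidistant_triple S (center t) (f t.1.1) (f t.1.2) (f t.2).
Proof.
move=> /increasing_neq[n12 n13 n23]; split; first by split; apply: mem_enumerated.
split; first by rewrite !(inj_eq f_inj).
exact/circumcenterP/(orient_enumerated_neq0 gpS f_inj fS).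
Qed.

Lemma card_closer (t : triple) : increasing_triple t ->
  #|` closer S (center t) (f t.1.1)| = enc t.
Proof.
move=> /increasing_neq[n12 n13 n23].
apply: (@card_fset_enum _ _ _ f) => [i j _ _ /f_inj //|p].
have o0 := orient_enumerated_neq0 gpS f_inj fS n12 n13 n23.
rewrite mem_closer; split=> [/andP[/fS[q ->] h] | [q h ->]].
  by exists q; rewrite //= inside_edist.
by rewrite (mem_enumerated fS) -inside_edist.
Qed.

(** Of two concentric circles, the larger encloses whatever the smaller one does, and also the three
    points on the smaller one. *)
Lemma encl_closer_lt (t u : triple) x :
  center t = x -> center u = x -> increasing_triple t -> increasing_triple u ->
  edist x (f t.1.1) < edist x (f u.1.1) -> (enc t + 3 <= enc u)%N.
Proof.
move=> tx ux it iu lt.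
rewrite -(card_closer it) -(card_closer iu) tx ux.
have [[aS bS cS] [[ab ac bc] [xb xc]]] := equidistant_center it.
rewrite tx in xb xc.
set C := closer S x (f t.1.1).
have -> : (#|` C| + 3 = #|` (f t.1.1 |` (f t.1.2 |` (f t.2 |` C)))%fset|)%N.
  rewrite !cardfsU1 !inE /= -xb -xc ltxx !andbF !orbF negb_or ab ac bc /=.
  by rewrite addnC.
apply: fsubset_leq_card; apply/fsubsetP => p; rewrite !inE.
move=> /or4P[/eqP->|/eqP->|/eqP->|/andP[pS xp]]; rewrite ?aS ?bS ?cS -?xb -?xc //=.
by rewrite pS (lt_trans xp).
Qed.

(** Distinct triples may share a centre, but then their radii differ and their counts differ by at
    least 3. Hence the triples relevant to one order, whose counts differ by at most 1, have
    distinct centres. *)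
Lemma center_inj (t u : triple) : increasing_triple t -> increasing_triple u ->
  (enc t <= (enc u).+1)%N -> (enc u <= (enc t).+1)%N -> center t = center u -> t = u.
Proof.
move=> it iu tu ut e.
have ht := equidistant_center it; have hu := equidistant_center iu.
rewrite -e in hu; set x := center t in e ht hu.
have {tu ut} xtu : edist x (f t.1.1) = edist x (f u.1.1).
  case: (ltgtP (edist x (f t.1.1)) (edist x (f u.1.1))) => // lt.
  - by have := encl_closer_lt (erefl x) (esym e) it iu lt; lia.
  - by have := encl_closer_lt (esym e) (erefl x) iu it lt; lia.
have [[aS bS cS] [_ [xb xc]]] := hu.
have mem i : f i \in S -> edist x (f u.1.1) = edist x (f i) ->
    [|| i == t.1.1, i == t.1.2 | i == t.2].
  move=> iS xi; have := equidistant_mem gpS ht iS; rewrite xtu xi => /(_ erefl).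
  by case=> /f_inj ->; rewrite eqxx ?orbT.
have := mem _ aS erefl; have := mem _ bS xb; have := mem _ cS xc.
move: it iu; clear; case: t u => [[i j] k] [[i' j'] k'].
rewrite /increasing_triple /= -!val_eqE /= => h1 h2 h3 h4 h5.
by congr (_, _, _); apply/val_inj => /=; lia.
Qed.

Lemma num_voronoi_verticesE k : num_voronoi_vertices S k =
  (\sum_(t | increasing_triple t) (((enc t).+1 == k) + ((enc t).+2 == k)))%N.
Proof.
pose P := [pred t : triple | increasing_triple t &&
  (((enc t).+1 == k) || ((enc t).+2 == k))].
transitivity #|P|; last first.
  rewrite -sum1_card big_mkcondr /=; apply: eq_bigr => t _.
  by case: (eqVneq (enc t).+1 k) => [<-|_] /=; [rewrite eqn_leq ltnn|case: eqP].
apply: (@card_fset_enum _ _ _ (fun t => center t)).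
  move=> t u /andP[it ht] /andP[iu hu]; apply: center_inj => //.
    by move: ht hu; lia.
  by move: ht hu; lia.
move=> x; rewrite in_fset_set; last exact: finite_voronoi_vertices.
rewrite inE; split; last first.
  move=> [t /andP[it ht] ->]; apply/(voronoi_vertexP gpS).
  exists (f t.1.1), (f t.1.2), (f t.2); split; first exact: equidistant_center.
  by rewrite card_closer //; case/orP: ht => /eqP; [left|right].
move=> /(voronoi_vertexP gpS)[a [b [c [h hk]]]].
have [[/fS[i ai] /fS[j bj] /fS[l cl]] _] := h; move: h hk; rewrite ai bj cl => h hk.
pose Q i j l := equidistant_triple S x (f i) (f j) (f l) /\
  ((#|` closer S x (f i)|).+1 = k \/ (#|` closer S x (f i)|).+2 = k).
have swap i' j' l' : Q i' j' l' -> Q j' i' l' /\ Q j' l' i'.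
  move=> [h' hk']; have [h1 h2] := equidistant_perm h'.
  have [_ [_ [xj _]]] := h'.
  have e : closer S x (f j') = closer S x (f i').
    by apply/fsetP => p; rewrite !mem_closer xj.
  by split; split; rewrite // e.
(* The triple found at a vertex comes in no particular order; [Q] is invariant under the six
   permutations, one of which is increasing. *)
have sorted (i' j' l' : 'I_n) : (i' < j')%N -> (j' < l')%N -> Q i' j' l' ->
    exists2 t, P t & x = center t.
  move=> ij jl [h' hk'].
  have it : increasing_triple (i', j', l') by rewrite /increasing_triple /= ij jl.
  have [[aS bS cS] [[ab ac bc] [xb xc]]] := h'.
  have xE := circumcenter_eq gpS aS bS cS ab ac bc xb xc.
  exists (i', j', l') => //; rewrite /= it -(card_closer it) /= -xE.
  by case: hk' => ->; rewrite eqxx ?orbT.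
have q : Q i j l by split.
have [q1 q2] := swap _ _ _ q; have [q3 q4] := swap _ _ _ q2.
have [q5 _] := swap _ _ _ q4.
have [_ [[]]] := h; rewrite !(inj_eq f_inj) -!val_eqE /= => ij il jl _.
case: (ltngtP i j) ij => // ij _; case: (ltngtP i l) il => // il _;
  case: (ltngtP j l) jl => // jl _.
all: by [exact: sorted q|exact: sorted q1|exact: sorted q2|exact: sorted q3
  |exact: sorted q4|exact: sorted q5|lia].
Qed.

Definition enclosure_poly (K : comNzRingType) : {poly K} :=
  \sum_(t | increasing_triple t) 'X^(enc t).

Lemma enclosure_poly_horner (K : comNzRingType) (z : K) :
  (enclosure_poly K).[z] = \sum_(t | increasing_triple t) z ^+ enc t.
Proof. by rewrite horner_sum; under eq_bigr do rewrite hornerXn. Qed.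

(* An increasing triple [i < j < k] occurs in the pencils of its three pairs, with
   sign -1 for the pair [i, k] and +1 for the two others. *)
Lemma counterclockwise_enclosure (K : comNzRingType) (z : K) :
  counterclockwise f ->
  (1 - z) * \sum_(t | increasing_triple t) z ^+ enc t =
  \sum_(i < n) \sum_(m < n | (i < m)%N) (z ^+ (m - i.+1) - z ^+ (n.-1 - (m - i))).
Proof.
move=> ccw.
(* The points to the right of the chord from [i] to [m] are those with index strictly between. *)
have sgn (i m p : 'I_n) : (i < m)%N -> p != i -> p != m ->
    (0 < orient (f i) (f m) (f p)) = ~~ ((i < p)%N && (p < m)%N) /\
    (orient (f i) (f m) (f p) < 0) = ((i < p)%N && (p < m)%N).
  rewrite -!val_eqE /= => im pi pm.
  have [ip|pi'] := ltnP i p; have [mp|pm'] := ltnP p m => /=; last by lia.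
  - have -> : orient (f i) (f m) (f p) = - orient (f i) (f p) (f m).
      by rewrite /orient; ring.
    by rewrite oppr_gt0 oppr_lt0 ccw // ltNge ltW // ccw.
  - have lt : (m < p)%N by lia.
    by rewrite ccw // ltNge ltW // ccw.
  - have lt : (p < i)%N by lia.
    by rewrite -orient_rot -orient_rot ccw // ltNge ltW // ccw.
have pencil (i m : 'I_n) : (i < m)%N ->
    (1 - z) * \sum_(p | (p != i) && (p != m))
      (if (i < p)%N && (p < m)%N then -1 else 1) * z ^+ encl f i m p =
    z ^+ (m - i.+1) - z ^+ (n.-1 - (m - i)).
  move=> im; have nim : i != m by rewrite -val_eqE /= ltn_eqF.
  have o1 : orient (f i) (f m) (f i) = 0 by rewrite /orient; ring.
  have o2 : orient (f i) (f m) (f m) = 0 by rewrite /orient; ring.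
  transitivity (z ^+ #|[pred p | orient (f i) (f m) (f p) < 0]| -
    z ^+ #|[pred p | 0 < orient (f i) (f m) (f p)]|).
    rewrite -(pencil_encl gpS f_inj fS) //; congr (_ * _).
    by apply: eq_bigr => p /andP[pi pm]; have [-> _] := sgn _ _ _ im pi pm; case: ifP.
  congr (_ ^+ _ - _ ^+ _).
    rewrite -(card_ord_interval i.+1 (ltnW (ltn_ord m))); apply: eq_card => p.
    rewrite !inE; have [->|pi] := eqVneq p i; first by rewrite o1 !ltxx ltnn.
    have [->|pm] := eqVneq p m; first by rewrite o2 !ltxx ltnn andbF.
    by have [_ ->] := sgn _ _ _ im pi pm.
  have c := card_ord_interval i (ltn_ord m).
  have := cardC [pred p : 'I_n | (i <= p)%N && (p < m.+1)%N]; rewrite card_ord c => cn.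
  transitivity #|predC [pred p : 'I_n | (i <= p)%N && (p < m.+1)%N]|; last first.
    rewrite -[LHS](addKn (m.+1 - i)) cn.
    by have := ltn_ord m; move: im; clear; lia.
  apply: eq_card => p; rewrite !inE.
  have [->|pi] := eqVneq p i; first by rewrite o1 ltxx leqnn ltnS ltnW.
  have [->|pm] := eqVneq p m; first by rewrite o2 ltxx leqnn ltnW.
  have [-> _] := sgn _ _ _ im pi pm.
  by move: pi pm; rewrite -!val_eqE /=; lia.
under [RHS]eq_bigr => i _ do under eq_bigr => m im do rewrite -pencil //.
under [RHS]eq_bigr => i _ do rewrite -mulr_sumr.
rewrite -mulr_sumr; congr (_ * _).
have G12 i j k : z ^+ encl f i j k = z ^+ encl f j i k by rewrite encl_swap12.
have G23 i j k : z ^+ encl f i j k = z ^+ encl f i k j by rewrite encl_swap23.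
have /= [m1 m2 m3] := increasing_triple_mark G12 G23.
pose G i j k := z ^+ encl f i j k.
transitivity (\sum_i \sum_j \sum_k G i j k *+ ((k < i)%N && (i < j)%N) +
  \sum_i \sum_j \sum_k G i j k *+ ((i < j)%N && (j < k)%N) -
  \sum_i \sum_j \sum_k G i j k *+ ((i < k)%N && (k < j)%N)).
  by rewrite m1 m2 m3 addrK.
rewrite /G.
rewrite -big_split -sumrB; apply: eq_bigr => i _ /=.
rewrite -big_split -sumrB [RHS]big_mkcond; apply: eq_bigr => m _ /=.
rewrite -big_split -sumrB /=; case: ltnP => im; last first.
  rewrite big1 // => p _; rewrite andbF andFb mulr0n addr0 add0r.
  by rewrite (_ : _ && _ = false) ?oppr0 //; lia.
rewrite [RHS]big_mkcond; apply: eq_bigr => p _ /=; rewrite andbT -!val_eqE /=.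
case: (ltngtP p i) => pi; case: (ltngtP p m) => pm //=;
  rewrite ?mulr0n ?mulr1n ?addr0 ?add0r ?subr0 ?mul1r ?mulN1r ?oppr0 //; lia.
Qed.

Hypothesis n2 : (2 < n)%N.

Lemma counterclockwise_roots (C : numClosedFieldType) (z : C) :
  counterclockwise f -> root (enclosure_poly C) z -> `|z| = 1.
Proof.
move=> ccw /rootP; rewrite enclosure_poly_horner => z0.
have := counterclockwise_enclosure z ccw; rewrite z0 mulr0 => /esym.
case: n n2 => [//|[//|N]] N0 e.
apply: (@norm_eq1_of_trinomial _ z N); first by [].
by rewrite -sum_arcs e mulr0.
Qed.

Hypothesis Sn : #|` S| = n.

Lemma voronoi_polyE : voronoi_poly S = (1 + 'X) * enclosure_poly R[i].
Proof.
rewrite /voronoi_poly Sn mulr_sumr.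
under eq_bigr do rewrite num_voronoi_verticesE natr_sum scaler_suml.
rewrite exchange_big; apply: eq_bigr => t it.
have [n12 n13 n23] := increasing_neq it.
have en := encl_le f_inj n12 n13 n23.
under eq_bigr do rewrite natrD scalerDl.
(* A triple with count [e] contributes at the orders [e + 1] and [e + 2]; both lie in the range of
   summation because [e <= n - 3]. *)
have one m : (0 < m < n)%N ->
    \sum_(1 <= k < n) (m == k)%:R *: 'X^(k.-1) = 'X^(m.-1) :> {poly R[i]}.
  move=> mn; rewrite (bigD1_seq m) ?iota_uniq ?mem_index_iota //= eqxx scale1r.
  rewrite big1 ?addr0 // => k; rewrite eq_sym => /negbTE ->.
  by rewrite scale0r.
by rewrite big_split /= !one ?mulrDl ?mul1r -?exprS //; lia.
Qed.

End Polynomial.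

(** * From roots on the unit circle to convex position *)

Section Converse.
Variables (R : realType) (S : {fset 'rV[R]_2}) (n : nat) (f : 'I_n -> 'rV[R]_2).
Hypothesis gpS : general_position S.
Hypothesis f_inj : injective f.
Hypothesis fS : forall p, p \in S <-> exists i, p = f i.
Hypothesis n2 : (2 < n)%N.
Hypothesis radial : forall i j k : 'I_n, i = 0 :> nat -> (0 < j)%N -> (j < k)%N ->
  0 < orient (f i) (f j) (f k).

Notation triple := ('I_n * 'I_n * 'I_n)%type.
Notation enc t := (encl f t.1.1 t.1.2 t.2).

(* The segment from the first point to the second is a hull edge; of the circles
   through its endpoints and a third point, the largest contains all others. *)
Lemma outermost_circle : exists2 t : triple, increasing_triple t & enc t = (n - 3)%N.
Proof.
have n0 : (0 < n)%N by apply: leq_trans n2.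
have n1 : (1 < n)%N by apply: leq_trans n2.
pose i := Ordinal n0; pose j := Ordinal n1; pose k := Ordinal n2.
pose t r := diametral (f i) (f j) (f r) / orient (f i) (f j) (f r).
have [p pj pmax] := @Order.TotalTheory.arg_maxP _ _ 'I_n k (fun r => (1 < r)%N) t erefl.
exists (i, j, p); first by rewrite /increasing_triple /= pj.
have neq (q : 'I_n) : (1 < q)%N -> q != i /\ q != j.
  by rewrite -!val_eqE /= => h; split; lia.
have [npi npj] := neq p pj.
have nij : i != j by [].
rewrite encl_sum // -(@sum_avoiding _ i j p) //; try by rewrite eq_sym.
apply: eq_bigr => q /= /and3P[qi qj qp].
have q1 : (1 < q)%N by move: qi qj; rewrite -!val_eqE /=; lia.
have tqp : t q <= t p := pmax q q1.
have ntqp : t q != t p by apply: contra_neq qp; apply: (pencil_inj gpS f_inj fS).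
by rewrite (inside_pencil gpS f_inj fS) //= radial // lt_neqAle ntqp tqp.
Qed.

(** The outermost circle attains the maximal exponent, and its coefficient, a positive natural
    number, cannot vanish in [C]. *)
Lemma size_enclosure_poly (C : numClosedFieldType) :
  size (enclosure_poly f C) = (n - 3).+1.
Proof.
have [t0 it0 e0] := outermost_circle.
apply/eqP; rewrite eqn_leq; apply/andP; split.
  apply: (leq_trans (size_sum _ _ _)); apply/bigmax_leqP => t it.
  have [n12 n13 n23] := increasing_neq it.
  by rewrite size_polyXn ltnS encl_le.
apply: contraT; rewrite -leqNgt => /leq_sizeP/(_ _ (leqnn _))/eqP.
rewrite coef_sum; under eq_bigr do rewrite coefXn.
rewrite -natr_sum pnatr_eq0 sum_nat_eq0 => /forall_inP/(_ t0 it0).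
by rewrite e0 eqxx.
Qed.

(* The roots force [2 P'(1) = (n - 3) P(1)]. Counted by quadruples, this says that
   the average number of points of a quadruple enclosed by the circle through the
   other three is 2, which is also the maximum. *)
Lemma roots_enclosed_count (C : numClosedFieldType) :
  (forall z, root (enclosure_poly f C) z -> `|z| = 1) ->
  forall a b c d : 'I_n, (a < b)%N -> (b < c)%N -> (c < d)%N ->
    enclosed_count (f a) (f b) (f c) (f d) = 2%N.
Proof.
move=> rt.
pose A := #|[pred t : triple | increasing_triple t]|.
pose B := (\sum_(t | increasing_triple t) enc t)%N.
have PA : (enclosure_poly f C).[1] = A%:R.
  rewrite enclosure_poly_horner; under eq_bigr do rewrite expr1n.
  by rewrite sumr_const.
have PB : (enclosure_poly f C)^`().[1] = B%:R.
  rewrite raddf_sum horner_sum natr_sum; apply: eq_bigr => t _ /=.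
  by rewrite derivXn hornerMn hornerXn expr1n.
have A0 : (0 < A)%N.
  by have [t it _] := outermost_circle; apply/card_gt0P; exists t.
have := deriv_unit_circle (size_enclosure_poly C) rt A0 PA PB.
pose G := fun i j k q : 'I_n => inside (f i) (f j) (f k) (f q) : nat.
have -> : B = (\sum_a \sum_b \sum_c \sum_d
     enclosed_count (f a) (f b) (f c) (f d) * [&& a < b, b < c & c < d])%N.
  rewrite -(sum_increasing_quadruple G); apply: eq_bigr => t it.
  exact: encl_sum.
have -> : ((n - 3) * A = \sum_(a < n) \sum_(b < n) \sum_(c < n) \sum_(d < n)
     4 * [&& a < b, b < c & c < d])%N.
  rewrite -(sum_increasing_quadruple (fun _ _ _ _ => 1%N)) mulnC.
  rewrite -sum_nat_const; apply: eq_bigr => t it.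
  by have [n12 n13 n23] := increasing_neq it; rewrite sum_avoiding.
have le2 (a b c d : 'I_n) : (a < b)%N -> (b < c)%N -> (c < d)%N ->
    (enclosed_count (f a) (f b) (f c) (f d) <= 2)%N.
  move=> ab bc cd; apply: enclosed_count_le2.
  by apply: (incircle_enumerated_neq0 gpS f_inj fS); rewrite -val_eqE /=; lia.
(* The deficit of a quadruple from the maximum. The truncated subtraction is exact by [le2], and
   since the deficits add up to zero, each of them is zero. *)
pose D (a b c d : 'I_n) := ((4 - 2 * enclosed_count (f a) (f b) (f c) (f d)) *
  [&& a < b, b < c & c < d])%N.
have -> : (\sum_(a < n) \sum_(b < n) \sum_(c < n) \sum_(d < n)
     4 * [&& a < b, b < c & c < d] = 2 * (\sum_a \sum_b \sum_c \sum_d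
     enclosed_count (f a) (f b) (f c) (f d) * [&& a < b, b < c & c < d]) +
     \sum_a \sum_b \sum_c \sum_d D a b c d)%N.
  rewrite big_distrr -big_split; apply: eq_bigr => a _ /=.
  rewrite big_distrr -big_split; apply: eq_bigr => b _ /=.
  rewrite big_distrr -big_split; apply: eq_bigr => c _ /=.
  rewrite big_distrr -big_split; apply: eq_bigr => d _ /=.
  rewrite /D; case: (boolP [&& _, _ & _]) => [/and3P[ab bc cd]|_]; last first.
    by rewrite !muln0.
  by have := le2 _ _ _ _ ab bc cd; lia.
rewrite -{1}[(2 * _)%N]addn0 => /addnI/esym/eqP D0 a b c d ab bc cd.
move: D0; rewrite sum_nat_eq0 => /forall_inP/(_ a isT).
rewrite sum_nat_eq0 => /forall_inP/(_ b isT).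
rewrite sum_nat_eq0 => /forall_inP/(_ c isT).
rewrite sum_nat_eq0 => /forall_inP/(_ d isT).
by rewrite /D ab bc cd muln1; have := le2 _ _ _ _ ab bc cd; lia.
Qed.

(** Joined with the first point, the triple gives a quadruple whose three orientations at that point
    are positive by [radial]; a count of 2 then forces the fourth. *)
Lemma roots_counterclockwise (C : numClosedFieldType) :
  (forall z, root (enclosure_poly f C) z -> `|z| = 1) -> counterclockwise f.
Proof.
move=> rt b c d bc cd.
have [b0|b0] := posnP b; first by apply: radial; rewrite // -b0.
have n0 : (0 < n)%N by apply: leq_trans n2.
pose o := Ordinal n0.
have oE : o = 0 :> nat by [].
have c0 : (0 < c)%N by apply: ltn_trans bc.
apply: (@enclosed_count_eq2 _ (f o)).
- by apply: (incircle_enumerated_neq0 gpS f_inj fS); rewrite -val_eqE /=; lia.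
- by apply: (orient_enumerated_neq0 gpS f_inj fS); rewrite -val_eqE /=; lia.
- exact: radial.
- by apply: radial => //; apply: ltn_trans cd.
- exact: radial.
- exact: (roots_enclosed_count rt).
Qed.

End Converse.

Theorem theorem10 (R : realType) (S : {fset 'rV[R]_2})
    (hn : (4 <= #|` S|)%N) (hS : general_position S) :
  convex_position S <->
  (forall z : R[i], root (voronoi_poly S) z -> (`|z| = 1)%R).
Proof.
have n2 : (2 < #|` S|)%N by apply: ltnW.
have n0 : (0 < #|` S|)%N by apply: leq_trans n2.
have [f [f_inj fS radial]] := radial_enumeration hS erefl n0.
have pE := voronoi_polyE hS f_inj fS n2 erefl.
split=> [cS z|rt].
  have ccw := convex_counterclockwise hS f_inj fS radial cS.
  rewrite pE rootM => /orP[|]; last exact: (counterclockwise_roots hS f_inj fS n2).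
  (* The factor [1 + 'X] contributes the root -1. *)
  by rewrite rootE !hornerE addrC addr_eq0 => /eqP ->; rewrite normrN1.
apply: (counterclockwise_convex fS n2).
apply: (@roots_counterclockwise _ _ _ _ hS f_inj fS n2 radial R[i]) => z rz.
by apply: rt; rewrite pE rootM rz orbT.
Qed.
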